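(* Let $s\ge 2$ be an integer, and let $X$ and $Y$ be two connected bipartite graphs of order $n$. Then: (i) if $\Delta(X)+\kappa(Y)\ge n+s-1$ and $Y\not\cong C_n$, then $\mathrm{FS}(X,Y)$ has exactly two connected components and each connected component is $s$-connected; (ii) for any integers $\Delta$ and $\kappa$ that satisfy $\Delta+\kappa\le n$, $\Delta\le n-1$ and $1\le \kappa\le \lfloor n/2\rfloor$, there exists a connected bipartite graph $X$ (of order $n$) with $\Delta(X)=\Delta$ such that for any connected bipartite graph $Y$ (of order $n$) with $\kappa(Y)=\kappa$, the graph $\mathrm{FS}(X,Y)$ has at least three connected components.
   Context: All graphs are simple; the order of a graph is its number of vertices. For two graphs $X,Y$ of the same order $n$, the friends-and-strangers graph $\mathrm{FS}(X,Y)$ has as vertices all bijections $\sigma:V(X)\to V(Y)$; two bijections $\sigma,\sigma'$ are adjacent if and only if there are distinct $a,b\in V(X)$ with $ab\in E(X)$, $\sigma(a)\sigma(b)\in E(Y)$, $\sigma(a)=\sigma'(b)$, $\sigma(b)=\sigma'(a)$, and $\sigma(c)=\sigma'(c)$ for all $c\in V(X)\setminus\{a,b\}$. $\Delta(G)$ is the maximum degree of $G$. A graph $G$ is $s$-connected if the graph resulting from removing any $s-1$ vertices of $G$ is still connected; the vertex connectivity $\kappa(G)$ is the maximum value of $s$ for which $G$ is $s$-connected (with the convention $\kappa(K_n)=n-1$ for the complete graph $K_n$). $C_n$ is the cycle of order $n$.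
   Formalization: Part (ii) is stated for n ≥ 4 and Δ ≥ 2 only: for Δ ≤ 1 and n ≥ 3 no connected graph X of order n has maximum degree Δ, and for n = 2 or 3 the claim fails (X = Y = K_2 gives one component, X = Y = P_3 gives two). *)

(* Defs.v *)
From HB Require Import structures.
From mathcomp Require Import all_boot.

Set Implicit Arguments.
Unset Strict Implicit.
Unset Printing Implicit Defensive.

Record sgraph := SGraph {
  vertex :> finType;
  adj : rel vertex;
  adj_sym : symmetric adj;
  adj_irrefl : irreflexive adj
}.

Definition max_degree (G : sgraph) : nat :=
  \max_(x : G) #|[set y : G | adj x y]|.

Definition bipartite (G : sgraph) : Prop :=
  exists A : {set G}, forall x y : G, adj x y -> (x \in A) != (y \in A).

Definition isomorphic (G H : sgraph) : Prop :=
  exists2 f : G -> H, bijective f & forall x y : G, adj (f x) (f y) = adj x y.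

Section Induced.
Variables (G : sgraph) (A : {set G}).
Definition induced_adj : rel {x : G | x \in A} := fun u v => adj (val u) (val v).
Lemma induced_adj_sym : symmetric induced_adj.
Proof. by move=> u v; exact: adj_sym. Qed.
Lemma induced_adj_irrefl : irreflexive induced_adj.
Proof. by move=> u; exact: adj_irrefl. Qed.
Definition induced : sgraph := SGraph induced_adj_sym induced_adj_irrefl.
End Induced.

Definition components (G : sgraph) : {set {set G}} :=
  equivalence_partition (connect (@adj G)) [set: G].

Definition connected (G : sgraph) : bool := #|components G| == 1.

Definition s_connected (s : nat) (G : sgraph) : bool :=
  [forall S : {set G}, (#|S|.+1 == s) ==> connected (induced (~: S))].

(* The maximum is taken over s < #|G| because deleting #|G| - 1 vertices leaves
   a single vertex, so every graph passes the test for s = #|G|. For s = #|G| - 1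
   the test holds exactly when G is complete, which gives kappa(K_n) = n - 1. *)
Definition connectivity (G : sgraph) : nat :=
  \max_(s < #|G| | s_connected s G) s.

(* This is C_n for n >= 3. *)
Section Cycle.
Variable n : nat.
Definition cycle_adj : rel 'I_n :=
  fun i j => (i != j) && ((j == i.+1 %% n :> nat) || (i == j.+1 %% n :> nat)).
Lemma cycle_adj_sym : symmetric cycle_adj.
Proof. by move=> i j; rewrite /cycle_adj eq_sym orbC. Qed.
Lemma cycle_adj_irrefl : irreflexive cycle_adj.
Proof. by move=> i; rewrite /cycle_adj eqxx. Qed.
Definition cycle_graph : sgraph := SGraph cycle_adj_sym cycle_adj_irrefl.
End Cycle.

Section FriendsAndStrangers.
Variables X Y : sgraph.

Definition bijectiveb (f : {ffun X -> Y}) : bool :=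
  injectiveb f && [forall y, y \in codom f].

Lemma bijectivebP (f : {ffun X -> Y}) : reflect (bijective f) (bijectiveb f).
Proof.
apply: (iffP andP) => [[/injectiveP f_inj /forallP f_surj]|f_bij].
  exists (fun y => iinv (f_surj y)) => [x|y]; last exact: f_iinv.
  by apply: f_inj; exact: f_iinv.
split; first by apply/injectiveP; exact: bij_inj.
by apply/forallP=> y; have [g _ gK] := f_bij; rewrite -(gK y) codom_f.
Qed.

Definition bijection : finType := {f : {ffun X -> Y} | bijectiveb f}.

Definition fs_adj : rel bijection := fun sigma sigma' =>
  [exists a : X, exists b : X,
    [&& a != b, adj a b, adj (val sigma a) (val sigma b),
        val sigma a == val sigma' b, val sigma b == val sigma' a &
        [forall c : X, (c \notin [set a; b]) ==> (val sigma c == val sigma' c)]]].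

Lemma fs_adj_sym : symmetric fs_adj.
Proof.
suff H u v : fs_adj u v -> fs_adj v u by move=> u v; apply/idP/idP; exact: H.
case/existsP=> a /existsP[b].
case/and5P=> nab Xab Yab /eqP uva /andP[/eqP uvb /forallP uvc].
apply/existsP; exists a; apply/existsP; exists b.
rewrite nab Xab -uva -uvb adj_sym Yab !eqxx /=.
by apply/forallP=> c; rewrite eq_sym; exact: uvc.
Qed.

Lemma fs_adj_irrefl : irreflexive fs_adj.
Proof.
move=> u; apply/idP => /existsP[a /existsP[b]].
case/and5P=> _ _ + /eqP uab _.
by rewrite uab adj_irrefl.
Qed.

Definition FS : sgraph := SGraph fs_adj_sym fs_adj_irrefl.

End FriendsAndStrangers.

(* Main.v *)
Require Import Defs.
From mathcomp Require Import all_boot all_fingroup cyclic zify.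

(** Arrangements of people on positions are viewed as permutations of one vertex
    set, a move being a swap along an edge of both graphs.

    A move changes the sign of the permutation and also the parity of the number of
    positions on one side of [X] whose occupant is on a given side of [Y]. The sum
    of the two is therefore invariant ([swap_parity]). For the first part it remains
    to see that two arrangements of the same parity stay joined after the deletion
    of fewer than [s] others ([swap_connect_avoiding]): this gives the two
    components and their connectivity at once.

    The proof is by induction on the set of positions at which the arrangements may
    differ, which grows from the closed star at a vertex [c] of maximum degree. When
    one more position [x] is freed, its occupant can be changed along a path in what
    is left of [Y], and the abundance of neighbours of [c] leaves room to avoid the
    deleted arrangements ([joined_extend]). This reduces everything to the star, that
    is, to the sliding puzzle in which [c] is a hole that moves on a graph obtained
    from [Y] by removing at most [connectivity Y - s] vertices; this graph is still
    [s]-connected, and it has a vertex of degree at least three.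

    For the sliding puzzle two facts are needed. One is Wilson's theorem for bipartite
    graphs ([wilson]). It rests on Jordan's relation: two places are linked when a
    3-cycle through both of them is realised by a closed walk of the hole. In a theta
    graph an explicit word gives one 3-cycle, and rotations link all the other places
    to it ([arcs_linked]); adding ears spreads the links to the whole graph
    ([ear_solvable], [grow_solvable]), and linked places generate the alternating
    group ([linked_cycle3], [cycle3_even]). The other fact is that deleting a state
    [w] can be compensated: two neighbours of [w] are joined by turning a suitable
    cycle through the hole until it has come full circle ([slide_detour]).

    For the second part [X] is a broom, a path whose last vertex carries the leaves,
    with a handle at least as long as a minimum separating set [Z] of [Y]. The side
    of [Y - Z] from which the first person outside [Z] along the handle comes is then
    invariant ([first_in_side_adj]). Together with the parity it takes four values. *)

Set Implicit Arguments.
Unset Strict Implicit.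
Unset Printing Implicit Defensive.

Import GroupScope.


(** * Connectivity of relations after deleting vertices *)

Definition avoiding (T : finType) (S : {set T}) (e : rel T) : rel T :=
  fun x y => [&& x \notin S, y \notin S & e x y].

Lemma connect_invariant (T : finType) (e : rel T) (P : T -> Prop) x y :
  P x -> (forall u v, P u -> e u v -> P v) -> connect e x y -> P y.
Proof.
move=> Px step /connectP[p]; elim: p x Px => [|z p IH] x Px /=; first by move=> _ ->.
by case/andP=> exz ezp yE; apply: IH ezp yE; apply: step exz.
Qed.
Arguments connect_invariant {T e} P {x y}.

Lemma avoiding_sym (T : finType) (S : {set T}) (e : rel T) :
  symmetric e -> symmetric (avoiding S e).
Proof. by move=> es x y; rewrite /avoiding es andbCA. Qed.

Lemma connect_mono (T : finType) (e e' : rel T) x y :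
  subrel e e' -> connect e x y -> connect e' x y.
Proof. by move=> ee'; apply: connect_sub => u v /ee'; apply: connect1. Qed.

Lemma connect_trans1 (T : finType) (e : rel T) y x z :
  connect e x y -> e y z -> connect e x z.
Proof. by move=> cxy eyz; apply: connect_trans cxy (connect1 eyz). Qed.

(** Each visit of a walk to [w] is replaced by a detour between the neighbours
    of [w] met just before and just after it. *)
Lemma connect_bypass (T : finType) (S : {set T}) (e : rel T) (w x y : T) :
    symmetric e -> w \in S ->
    (forall u v, u \notin S -> v \notin S -> e u w -> e w v ->
       connect (avoiding S e) u v) ->
    x \notin S -> y \notin S ->
  connect (avoiding (S :\ w) e) x y -> connect (avoiding S e) x y.
Proof.
move=> es wS detour xS yS cxy.
pose P t := if t == w then forall u, u \notin S -> e u w -> connect (avoiding S e) x u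
            else connect (avoiding S e) x t.
suff: P y by rewrite /P ifN //; apply: contraNneq yS => ->.
apply: (connect_invariant P _ _ cxy); first by rewrite /P ifN //; apply: contraNneq xS => ->.
move=> u v; rewrite /P => Pu /and3P[]; rewrite !inE !negb_and !negbK => uS vS euv.
case: (eqVneq u w) Pu uS euv => [->|nuw] /= Pu uS euv;
  case: (eqVneq v w) vS euv => [->|nvw] //= vS euv.
- by apply: Pu => //; rewrite es.
- by move=> u' u'S eu'; apply: connect_trans Pu _; apply: detour; rewrite // es.
- by apply: (connect_trans1 Pu); rewrite /avoiding uS vS.
Qed.

(** * Graphs, components and vertex connectivity *)

Lemma connect_adj_sym (G : sgraph) : connect_sym (@adj G).
Proof. by apply: sym_connect_sym; apply: adj_sym. Qed.

Lemma components_def (G : sgraph) :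
  components G = [set [set y | connect (@adj G) x y] | x in [set: G]].
Proof.
rewrite /components /equivalence_partition; apply: eq_imset => x.
by apply/setP=> y; rewrite !inE.
Qed.

Lemma connected_connect (G : sgraph) (x y : G) : connected G -> connect (@adj G) x y.
Proof.
rewrite /connected components_def => /cards1P[C CE].
have compC (z : G) : [set t | connect (@adj G) z t] = C.
  by apply/set1P; rewrite -CE; apply: imset_f; rewrite inE.
by have /setP/(_ y) := etrans (compC x) (esym (compC y)); rewrite !inE connect0.
Qed.

Lemma connect_connected (G : sgraph) (x0 : G) :
  (forall x y, connect (@adj G) x y) -> connected G.
Proof.
move=> cG; rewrite /connected components_def; apply/cards1P; exists [set: G].
apply/setP=> C; rewrite inE; apply/imsetP/eqP => [[x _ ->]|->].
  by apply/setP=> y; rewrite !inE cG.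
by exists x0 => //; apply/setP=> y; rewrite !inE cG.
Qed.

(** Quantifying over all small sets and over two given survivors, rather than over
    sets of one size as in [s_connected], makes deleting vertices in two rounds
    immediate. *)
Definition k_connected (T : finType) (e : rel T) (k : nat) :=
  forall (S : {set T}) u v, #|S| < k -> u \notin S -> v \notin S ->
    connect (avoiding S e) u v.

Lemma connected_induced (G : sgraph) (S : {set G}) u v :
    connected (induced (~: S)) -> u \notin S -> v \notin S ->
  connect (avoiding S (@adj G)) u v.
Proof.
rewrite -!in_setC => cS uS vS.
have := connected_connect (Sub u uS : induced (~: S)) (Sub v vS) cS.
pose P (w : induced (~: S)) := connect (avoiding S (@adj G)) u (val w) : Prop.
move=> c; suff: P (Sub v vS) by [].
apply: (connect_invariant P _ _ c); first exact: connect0.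
move=> a b Pa ab; apply: (connect_trans1 Pa).
by rewrite /avoiding -!in_setC (valP a) (valP b).
Qed.

Lemma subset_of_card (T : finType) (A : {set T}) k :
  k <= #|A| -> exists2 B : {set T}, B \subset A & #|B| = k.
Proof.
move=> kA; have /set0Pn[B] : [set B : {set T} | (B \subset A) && (#|B| == k)] != set0.
  by rewrite -card_gt0 cards_draws bin_gt0.
by rewrite inE => /andP[sBA /eqP cB]; exists B.
Qed.

Lemma connectivity_bound (G : sgraph) : connectivity G <= #|G|.-1.
Proof.
by apply/bigmax_leqP => i _; have := ltn_ord i; lia.
Qed.

Lemma s_connected_connectivity (G : sgraph) :
  0 < connectivity G -> s_connected (connectivity G) G.
Proof.
rewrite /connectivity => pos.
case: (pickP [pred i : 'I_#|G| | s_connected i G]) => [i0 Pi0|none].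
  by rewrite (bigmax_eq_arg i0) //; case: arg_maxnP.
by rewrite big_pred0 in pos => // i; apply: none.
Qed.

(** A smaller set can be enlarged to the size tested by [s_connected] without
    touching [u] and [v], because the connectivity is less than the order. *)
Lemma k_connected_connectivity (G : sgraph) : k_connected (@adj G) (connectivity G).
Proof.
move=> S u v cS uS vS; set k := connectivity G in cS *.
have k_lt : k < #|G|.
  have := connectivity_bound G; have : 0 < #|G| by apply/card_gt0P; exists u.
  by rewrite -/k; lia.
have [D sD cD] : exists2 D : {set G}, D \subset ~: (S :|: [set u; v]) & #|D| = k.-1 - #|S|.
  apply: subset_of_card; have := cardsC (S :|: [set u; v]).
  have [+ _] := leq_card_setU S [set u; v]; rewrite cards2; case: (u != v); lia.
have dSD : #|S :|: D| = k.-1.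
  rewrite cardsU (_ : S :&: D = set0) ?cards0; first by rewrite cD; lia.
  apply/setP=> x; rewrite !inE; apply/negP => /andP[xS /(subsetP sD)].
  by rewrite !inE xS.
have cG : connected (induced (~: (S :|: D))).
  have /forallP/(_ (S :|: D)) := s_connected_connectivity (leq_ltn_trans (leq0n _) cS).
  by rewrite dSD -/k prednK ?eqxx //; lia.
have outD w : w \notin S -> w \in [set u; v] -> w \notin S :|: D.
  move=> wS wuv; rewrite inE (negPf wS) /=; apply/negP => /(subsetP sD).
  by rewrite inE in_setU wuv orbT.
have := connected_induced cG (outD u uS (set21 _ _)) (outD v vS (set22 _ _)).
apply: connect_mono => a b; rewrite /avoiding.
by rewrite !inE !negb_or => /and3P[/andP[-> _] /andP[-> _] ->].
Qed.

(** The neighbours of a vertex separate it from the rest of the graph. *)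
Lemma k_connected_degree (T : finType) (e : rel T) k (v : T) :
  irreflexive e -> k_connected e k -> k < #|T| -> k <= #|[set y | e v y]|.
Proof.
move=> ei kc kT; rewrite leqNgt; apply/negP => dv.
set S := [set y | e v y] in dv.
have vS : v \notin S by rewrite inE ei.
have [u uS] : exists u, u \notin v |: S.
  apply/existsP; rewrite -negb_forall; apply/negP => /forallP all_in.
  have := eq_card (fun x => all_in x : (x \in v |: S) = (x \in T)).
  rewrite cardsU1 vS -/(#|T|) => E.
  lia.
move: uS; rewrite in_setU1 negb_or => /andP[nuv uS].
suff : u = v by move/eqP; apply/negP.
apply: (connect_invariant (eq^~ v) _ _ (kc S v u dv vS uS)) => // a b ->.
by case/and3P=> _; rewrite inE => /negPf->.
Qed.

(** Adjacent vertices have disjoint neighbourhoods of at least [k] vertices each. *)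
Lemma k_connected_bipartite_card (T : finType) (e : rel T) (B : {set T}) k (v : T) :
    irreflexive e -> symmetric e -> (forall x y, e x y -> (x \in B) != (y \in B)) ->
    k_connected e k -> 0 < k < #|T| ->
  k.*2 <= #|T|.
Proof.
move=> ei es eB kc /andP[k0 kT].
have deg := k_connected_degree _ ei kc kT.
have /card_gt0P[w] : 0 < #|[set y | e v y]| by apply: leq_trans (deg v).
rewrite inE => evw.
have side x y : e v x -> e w y -> (x \in B) != (y \in B).
  move=> /eB vx /eB wy; move: (eB _ _ evw) vx wy.
  by case: (v \in B); case: (w \in B); case: (x \in B); case: (y \in B).
rewrite -addnn; apply: leq_trans (leq_add (deg v) (deg w)) _.
rewrite -cardsUI (_ : _ :&: _ = set0) ?cards0 ?addn0 ?max_card //.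
apply/setP=> x; rewrite !inE; apply/negP => /andP[vx wx].
by have := side _ _ vx wx; rewrite eqxx.
Qed.


(** * Three-cycles in permutation groups *)

Section ThreeCycles.
Variable T : finType.
Implicit Types (i j k a b : T) (g : {perm T}).

(** For distinct points this is the cycle [i -> j -> k -> i]. *)
Definition cycle3 i j k : {perm T} := tperm i j * tperm i k.

Lemma cycle3J i j k g : cycle3 i j k ^ g = cycle3 (g i) (g j) (g k).
Proof. by rewrite conjMg !tpermJ. Qed.

Lemma cycle3_1 i j k : i != j -> j != k -> cycle3 i j k i = j.
Proof. by move=> nij njk; rewrite permM tpermL tpermD // eq_sym. Qed.

Lemma cycle3_2 i j k : cycle3 i j k j = k.
Proof. by rewrite permM tpermR tpermL. Qed.

Lemma cycle3_3 i j k : k != i -> j != k -> cycle3 i j k k = i.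
Proof. by move=> nki njk; rewrite permM (tpermD (z := k)) ?tpermR // eq_sym. Qed.

Lemma cycle3D i j k t : t != i -> t != j -> t != k -> cycle3 i j k t = t.
Proof. by move=> ti tj tk; rewrite permM !(tpermD (z := t)) // eq_sym. Qed.

Lemma cycle3_rot i j k : uniq [:: i; j; k] -> cycle3 j k i = cycle3 i j k.
Proof.
rewrite /= !inE !negb_or => /andP[/andP[nij nik] /andP[njk _]].
apply/permP=> t; have [->|ti] := eqVneq t i.
  by rewrite cycle3_1 // cycle3_3 // eq_sym.
have [->|tj] := eqVneq t j; first by rewrite cycle3_2 cycle3_1 // eq_sym.
have [->|tk] := eqVneq t k; first by rewrite cycle3_2 cycle3_3 // eq_sym.
by rewrite !cycle3D.
Qed.

Lemma cycle3V i j k : uniq [:: i; j; k] -> (cycle3 i j k)^-1 = cycle3 j i k.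
Proof.
move=> u; rewrite -(cycle3_rot u) /cycle3 invMg !tpermV.
have [nij nik njk] : [/\ i != j, i != k & j != k].
  by move: u; rewrite /= !inE !negb_or => /andP[/andP[-> ->] /andP[-> _]].
by rewrite (tpermC j i).
Qed.

Lemma odd_cycle3 i j k : i != j -> i != k -> odd_perm (cycle3 i j k) = false.
Proof. by move=> nij nik; rewrite odd_mul_tperm odd_tperm nij nik. Qed.

Variable G : {group {perm T}}.

Lemma cycle3_sub i j k a b c :
    uniq [:: i; j; k] -> cycle3 i j k \in G ->
    {subset [:: a; b; c] <= [:: i; j; k]} -> uniq [:: a; b; c] ->
  cycle3 a b c \in G.
Proof.
move=> u gG sub.
have u1 : uniq [:: j; k; i] by move: u; rewrite -(rot_uniq 1).
have u2 : uniq [:: k; i; j] by move: u1; rewrite -(rot_uniq 1).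
have r1 : cycle3 j k i \in G by rewrite cycle3_rot.
have r2 : cycle3 k i j \in G by rewrite (cycle3_rot u1).
have s0 : cycle3 j i k \in G by rewrite -cycle3V // groupV.
have s1 : cycle3 k j i \in G by rewrite -(cycle3V u1) groupV.
have s2 : cycle3 i k j \in G by rewrite -(cycle3V u2) groupV.
have := sub a (mem_head _ _); have := sub b; have := sub c.
rewrite !inE !eqxx !orbT => /(_ isT)/or3P cs /(_ isT)/or3P bs /or3P as_.
by case: as_ => /eqP->; case: bs => /eqP->; case: cs => /eqP->;
  rewrite //= !inE ?eqxx ?orbT ?andbF.
Qed.

(** Jordan's relation: it is an equivalence that [G] preserves, so it lets a
    single 3-cycle of [G] spread over the points that [G] can reach from it. *)
Definition linked i j :=
  (i == j) || [exists k, uniq [:: i; j; k] && (cycle3 i j k \in G)].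

Lemma linkedP i j :
  reflect (i = j \/ exists2 k, uniq [:: i; j; k] & cycle3 i j k \in G) (linked i j).
Proof.
apply: (iffP orP) => [[/eqP->|/existsP[k /andP[u gk]]]|[->|[k u gk]]].
- by left.
- by right; exists k.
- by left.
- by right; apply/existsP; exists k; rewrite u.
Qed.

Lemma linked_refl i : linked i i. Proof. by apply/linkedP; left. Qed.

Lemma cycle3_linked i j k :
  uniq [:: i; j; k] -> cycle3 i j k \in G -> linked i j.
Proof. by move=> u gk; apply/linkedP; right; exists k. Qed.

Lemma linked_sym i j : linked i j = linked j i.
Proof.
suff H a b : linked a b -> linked b a by apply/idP/idP; apply: H.
case/linkedP=> [->|[k u gk]]; first exact: linked_refl.
apply/linkedP; right; exists k; last by rewrite -cycle3V // groupV.
by move: u; rewrite /= !inE !negb_or (eq_sym a b) => /andP[/andP[-> ->] /andP[-> _]].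
Qed.

Lemma linked_trans j i k : linked i j -> linked j k -> linked i k.
Proof.
case/linkedP=> [->//|[c uc gc]] /linkedP[<-|[e ue ge]].
  by apply: cycle3_linked uc gc.
have [->|nik] := eqVneq i k; first exact: linked_refl.
have [kc|nkc] := eqVneq k c.
  apply: (@cycle3_linked _ _ j); rewrite kc; last first.
    apply: (cycle3_sub uc gc); first by move=> t; rewrite !inE => /or3P[]->; rewrite ?orbT.
    by move: uc; rewrite /= !inE !negb_or (eq_sym c j) => /andP[/andP[-> ->] /andP[-> _]].
  by move: uc; rewrite /= !inE !negb_or (eq_sym c j) => /andP[/andP[-> ->] /andP[-> _]].
have njk : j != k by move: ue; rewrite /= !inE; case: (j == k).
have [nij nic njc] : [/\ i != j, i != c & j != c].
  by move: uc; rewrite /= !inE !negb_or => /andP[/andP[-> ->] /andP[-> _]].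
(* the inverse of the first 3-cycle sends [j] to [i] and fixes [k] *)
pose s := (cycle3 i j c)^-1.
have sj : s j = i by apply: (can_inj (permK (cycle3 i j c))); rewrite permKV cycle3_1.
have sk : s k = k.
  by apply: (can_inj (permK (cycle3 i j c))); rewrite permKV cycle3D // eq_sym.
apply: (@cycle3_linked _ _ (s e)); last by rewrite -sj -[in X in cycle3 _ X]sk -cycle3J groupJ ?groupV.
by have := ue; rewrite -(map_inj_uniq (@perm_inj _ s)) /= sj sk.
Qed.

Lemma linked_perm g i j : g \in G -> linked i j -> linked (g i) (g j).
Proof.
move=> gG /linkedP[->|[k u gk]]; first exact: linked_refl.
apply: (@cycle3_linked _ _ (g k)); last by rewrite -cycle3J groupJ.
by have := u; rewrite -(map_inj_uniq (@perm_inj _ g)).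
Qed.

(** Conjugating 3-cycles of [G] that share one or two points by one another moves
    a third point to any prescribed place. *)
Lemma linked_cycle3 (M : {set T}) :
    {in M &, forall i j, linked i j} ->
  {in M & &, forall a b x, uniq [:: a; b; x] -> cycle3 a b x \in G}.
Proof.
move=> lM a b x aM bM xM u.
have [nab nax nbx] : [/\ a != b, a != x & b != x].
  by move: u; rewrite /= !inE !negb_or => /andP[/andP[-> ->] /andP[-> _]].
have [/eqP|[c uc gc]] := linkedP _ _ (lM a b aM bM); first by rewrite (negPf nab).
have [/eqP|[k uk gk]] := linkedP _ _ (lM x a xM aM).
  by rewrite eq_sym (negPf nax).
have [_ nac nbc] : [/\ a != b, a != c & b != c].
  by move: uc; rewrite /= !inE !negb_or => /andP[/andP[-> ->] /andP[-> _]].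
have [_ nxk nak] : [/\ x != a, x != k & a != k].
  by move: uk; rewrite /= !inE !negb_or => /andP[/andP[-> ->] /andP[-> _]].
have [xc|nxc] := eqVneq x c; first by rewrite xc.
set s := cycle3 a b c in gc.
have sa : s a = b by apply: cycle3_1.
have sx : s x = x by apply: cycle3D; rewrite // eq_sym.
have [kb|nkb] := eqVneq k b.
  by apply: (cycle3_sub uk gk) => // t; rewrite kb !inE => /or3P[]->; rewrite ?orbT.
have [kc|nkc] := eqVneq k c.
  have sb : s b = c by apply: cycle3_2.
  have sc : s c = a by apply: cycle3_3; rewrite // eq_sym.
  have : cycle3 (s x) (s a) (s c) \in G by rewrite -cycle3J groupJ // -kc.
  rewrite sx sa sc => g1.
  apply: (cycle3_sub _ g1) => // [|t]; last by rewrite !inE => /or3P[]->; rewrite ?orbT.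
  by rewrite /= !inE !negb_or !(eq_sym x) nbx nax (eq_sym b) nab.
have sk : s k = k by apply: cycle3D; rewrite // eq_sym.
have uxbk : uniq [:: x; b; k].
  by rewrite /= !inE !negb_or (eq_sym x) nbx nxk (eq_sym b) nkb.
have : cycle3 (s x) (s a) (s k) \in G by rewrite -cycle3J groupJ.
rewrite sx sa sk => g2; set t := cycle3 x b k in g2.
have : cycle3 (t x) (t a) (t k) \in G by rewrite -cycle3J groupJ.
have -> : t x = b by apply: cycle3_1; rewrite // eq_sym.
have -> : t a = a by apply: cycle3D.
have -> : t k = x by apply: cycle3_3; rewrite // eq_sym.
move=> g3.
apply: (cycle3_sub _ g3) => // [|z]; last by rewrite !inE => /or3P[]->; rewrite ?orbT.
by rewrite /= !inE !negb_or (eq_sym b) nab nbx nax.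
Qed.

(** The alternating group is generated by 3-cycles: a 3-cycle on moved points
    that returns one of them to its place decreases the support. *)
Lemma cycle3_even (M : {set T}) :
    {in M & &, forall a b x, uniq [:: a; b; x] -> cycle3 a b x \in G} ->
  forall g, perm_on M g -> odd_perm g = false -> g \in G.
Proof.
move=> c3G g; have [n] := ubnP #|[set t | g t != t]|.
elim: n g => // n IH g; rewrite ltnS => card_g gM even_g.
have [x gx|fixg] := pickP [pred x | g x != x]; last first.
  rewrite (_ : g = 1) ?group1 //; apply/permP=> x; rewrite perm1.
  by apply/eqP; have := fixg x; rewrite /=; case: eqP.
rewrite /= in gx; set y := g x in gx.
have xM : x \in M by apply: (subsetP gM); rewrite inE.
have gy : g y != y by rewrite (inj_eq perm_inj).
have yM : y \in M by apply: (subsetP gM); rewrite inE.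
have [z|two] := pickP [pred z | [&& z != x, z != y & g z != z]]; last first.
  suff gE : g = tperm x y by move: even_g; rewrite gE odd_tperm eq_sym gx.
  apply/permP=> t; have [->|tx] := eqVneq t x; first by rewrite tpermL.
  have [->|ty] := eqVneq t y.
    by have := two (g y); rewrite /= inj_eq ?gy ?andbT ?tpermR; [move/eqP|exact: perm_inj].
  have := two t; rewrite /= tx ty /= => /negbFE/eqP->.
  by rewrite tpermD // eq_sym.
case/and3P=> zx zy gz.
have zM : z \in M by apply: (subsetP gM); rewrite inE.
have u : uniq [:: y; x; z] by rewrite /= !inE !negb_or gx (eq_sym y) zy (eq_sym x) zx.
have cG : cycle3 y x z \in G by apply: c3G.
rewrite -(groupMr _ cG); apply: IH.
- apply: leq_trans card_g; apply: proper_card; apply/properP; split.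
    apply/subsetP=> t; rewrite !inE; apply: contra => /eqP gt.
    have gtx : t != x by apply: contraNneq gx => tx; rewrite /y -tx gt.
    have gty : t != y by apply: contraNneq gy => <-; rewrite gt.
    have gtz : t != z by apply: contraNneq gz => <-; rewrite gt.
    by rewrite permM gt cycle3D.
  by exists x; rewrite !inE // permM cycle3_1 ?eqxx // eq_sym.
- apply/subsetP=> t; rewrite inE; apply: contraR => tM.
  have neqM s : s \in M -> t != s by move=> sM; apply: contraNneq tM => ->.
  by rewrite permM (out_perm gM) // cycle3D ?neqM.
- by rewrite odd_permM even_g odd_cycle3 // eq_sym.
Qed.

End ThreeCycles.


Ltac neq_hyp := first [by [] | by rewrite eq_sym].
Ltac tperm_fix t := rewrite (tpermD (z := t)); [|neq_hyp|neq_hyp].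

(** * Three cyclic permutations sharing one point *)

Section ThreeCyclesAtAPoint.
Variable T : finType.
Implicit Types (x y z g : {perm T}) (q t i j : T).

(** A single cycle through [q], or the identity. *)
Definition cycle_through q x := forall t, x t != t -> t \in porbit x q.
Definition meet_at q x y := forall t, x t != t -> y t != t -> t = q.

Lemma perm_fixV x t : (x^-1 t == t) = (x t == t).
Proof. by rewrite -(inj_eq (@perm_inj _ x)) permKV eq_sym. Qed.

Lemma meet_at_sym q x y : meet_at q x y -> meet_at q y x.
Proof. by move=> m t yt xt; apply: m. Qed.

Lemma meet_at_fix q x y t : meet_at q x y -> x t != t -> t != q -> y t = t.
Proof. by move=> m xt tq; apply/eqP; apply: contraNT tq => yt; apply/eqP; apply: m. Qed.

Lemma meet_at_fixV q x y t : meet_at q x y -> x t != t -> t != q -> y^-1 t = t.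
Proof. by move=> m xt tq; apply/eqP; rewrite perm_fixV (meet_at_fix m). Qed.

Lemma moved_step x t : (x (x t) == x t) = (x t == t).
Proof. by rewrite (inj_eq perm_inj). Qed.

Lemma moved_stepV x t : (x (x^-1 t) == x^-1 t) = (x t == t).
Proof. by rewrite permKV eq_sym perm_fixV. Qed.

Lemma moved_orbit x q t : t \in porbit x q -> t != q -> x t != t.
Proof.
case/porbitP=> i ->; apply: contraNneq => fix_t; apply/eqP.
have : (x ^+ i) (x q) = (x ^+ i) q by rewrite -!permM -expgS expgSr permM.
move/perm_inj => xq; elim: i {fix_t} => [|i IH]; first by rewrite perm1.
by rewrite expgSr permM IH.
Qed.

Lemma porbit_step x q t : t \in porbit x q -> x t \in porbit x q.
Proof. by case/porbitP=> i ->; rewrite -permM -expgSr mem_porbit. Qed.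

Lemma porbit_stepV x q t : t \in porbit x q -> x^-1 t \in porbit x q.
Proof. by rewrite -!(porbitV x); apply: porbit_step. Qed.

(** From [q], [x^-1 * y] runs backwards through the points of [x] and then forwards
    through those of [y], since each factor fixes the private points of the other. *)
Lemma orbit_glued q x y t : meet_at q x y ->
  t \in porbit x q \/ t \in porbit y q -> t \in porbit (x^-1 * y) q.
Proof.
move=> m; case; rewrite -porbitV => /porbitP[i ->].
  elim: i => [|i IH]; first by rewrite perm1 porbit_id.
  have [->|] := eqVneq ((x^-1 ^+ i.+1) q) q; first exact: porbit_id.
  move: IH; rewrite expgSr permM; set u := (x^-1 ^+ i) q => uO nq.
  have <- : (x^-1 * y) u = x^-1 u; last exact: porbit_step.
  rewrite permM; apply: (meet_at_fix m) => //; apply: moved_orbit (nq).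
  by rewrite porbit_stepV // -porbitV mem_porbit.
elim: i => [|i IH]; first by rewrite perm1 porbit_id.
have [->|] := eqVneq ((y^-1 ^+ i.+1) q) q; first exact: porbit_id.
move: IH; rewrite expgSr permM; set u := (y^-1 ^+ i) q => uO nq.
have <- : (x^-1 * y)^-1 u = y^-1 u; last exact: porbit_stepV.
rewrite invMg invgK permM; apply: (meet_at_fix (meet_at_sym m)) => //.
by apply: moved_orbit (nq); rewrite porbit_stepV // -porbitV mem_porbit.
Qed.

Lemma porbit_common x q s t : s \in porbit x q -> t \in porbit x q -> s \in porbit x t.
Proof. by rewrite -!eq_porbit_mem => /eqP-> /eqP->. Qed.

Variable G : {group {perm T}}.

Lemma linked_orbit g i j t :
  g \in G -> g i = i -> t \in porbit g j -> linked G j i -> linked G t i.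
Proof.
move=> gG gi /porbitP[n ->] lji.
have gni : (g ^+ n) i = i by elim: n => [|n IH]; rewrite ?perm1 // expgSr permM IH.
by rewrite -{1}gni; apply: linked_perm; rewrite ?groupX.
Qed.

(** A single nontrivial link spreads: the glued cycle on [x] and [y] fixes the
    private points of [z], and then the same holds with the roles exchanged. *)
Lemma linked_spread q x y z i j k :
    meet_at q x y -> meet_at q x z -> meet_at q y z ->
    x^-1 * y \in G -> x^-1 * z \in G -> y^-1 * z \in G ->
    z i != i -> i != q -> j \in porbit x q :|: porbit y q -> linked G j i ->
    k \in porbit x q :|: porbit y q -> k != q ->
  {in porbit x q :|: porbit y q :|: porbit z q, forall t, linked G t i}.
Proof.
move=> mxy mxz myz gxy gxz gyz zi iq jO lji kO nkq.
have lxy t : t \in porbit x q :|: porbit y q -> linked G t i.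
  rewrite in_setU => /orP tO; apply: (linked_orbit gxy _ _ lji).
    by rewrite permM (meet_at_fixV (meet_at_sym mxz)) // (meet_at_fix (meet_at_sym myz)).
  by move: jO; rewrite in_setU => /orP jO; apply: porbit_common; apply: (orbit_glued mxy).
have lki := lxy k kO.
have lqk : linked G q k.
  by rewrite linked_sym in lki; apply: linked_trans lki; apply: lxy; rewrite inE porbit_id.
have lz t : t \in porbit z q -> linked G t k.
  move=> tO; case/setUP: kO => kO; have mk := moved_orbit kO nkq.
    apply: (linked_orbit gyz _ (orbit_glued myz (or_intror tO)) lqk).
    by rewrite permM (meet_at_fixV mxy) // (meet_at_fix mxz).
  apply: (linked_orbit gxz _ (orbit_glued mxz (or_intror tO)) lqk).
  by rewrite permM (meet_at_fixV (meet_at_sym mxy)) // (meet_at_fix myz).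
by move=> t /setUP[/lxy//|/lz ltk]; apply: linked_trans ltk lki.
Qed.

(** Up to conjugation by [x] this is the commutator of [x * y^-1] and [x * z^-1].
    These two cycles overlap along [x], so that little survives. *)
Lemma double_transposition q x y z :
    meet_at q x y -> meet_at q x z -> meet_at q y z ->
    x q != q -> y q != q -> z q != q ->
  (y^-1 * x) * (z^-1 * y) * (x^-1 * z) = tperm q (x^-1 q) * tperm (y q) (z q).
Proof.
move=> mxy mxz myz xq yq zq; apply/permP=> t.
have myx := meet_at_sym mxy; have mzx := meet_at_sym mxz; have mzy := meet_at_sym myz.
have xVq : x^-1 q != q by rewrite perm_fixV.
have yVq : y^-1 q != q by rewrite perm_fixV.
have zVq : z^-1 q != q by rewrite perm_fixV.
have neq u v a b : meet_at q u v -> u a != a -> v b != b -> a != q -> a != b.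
  by move=> m ua vb aq; apply: contraNneq aq => ab; rewrite (m a) // ab.
rewrite !permM.
have [->|tq] := eqVneq t q.
  rewrite tpermL (meet_at_fix myx (t := y^-1 q)) ?moved_stepV //.
  rewrite (meet_at_fixV myz (t := y^-1 q)) ?moved_stepV // permKV.
  rewrite (meet_at_fix mxz (t := x^-1 q)) ?moved_stepV // tpermD //.
    by rewrite eq_sym (neq x y) ?moved_stepV ?moved_step.
  by rewrite eq_sym (neq x z) ?moved_stepV ?moved_step.
have [xt|xt] := boolP (x t == t); last first.
  rewrite (meet_at_fixV mxy) //.
  have [xtq|xtq] := eqVneq (x t) q.
    have -> : t = x^-1 q by rewrite -xtq permK.
    rewrite permKV tpermR (meet_at_fix mzy (t := z^-1 q)) ?moved_stepV //.
    rewrite (meet_at_fixV mzx (t := z^-1 q)) ?moved_stepV // permKV.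
    by rewrite tpermD // eq_sym.
  rewrite (meet_at_fixV mxz) ?moved_step // (meet_at_fix mxy) ?moved_step //.
  rewrite permK (meet_at_fix mxz) // (tpermD (z := t)); last 2 first.
  - by rewrite eq_sym.
  - by apply: contraNneq xtq => <-; rewrite permKV.
  rewrite tpermD // eq_sym; first by rewrite (neq x y) ?moved_step.
  by rewrite (neq x z) ?moved_step.
have nxVq : x^-1 q != t.
  by apply: contraTneq xt => <-; rewrite moved_stepV.
rewrite (tpermD (z := t)) 1?[q == t]eq_sym //.
have [yt|yt] := boolP (y t == t); last first.
  have [->|ytq] := eqVneq t (y q).
    rewrite permK tpermL.
    rewrite (meet_at_fixV mxz (t := x q)) ?moved_step // (meet_at_fix mxy) ?moved_step //.
    by rewrite permK.
  have yVt : y^-1 t != q by apply: contraNneq ytq => <-; rewrite permKV.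
  rewrite (meet_at_fix myx (t := y^-1 t)) ?moved_stepV //.
  rewrite (meet_at_fixV myz (t := y^-1 t)) ?moved_stepV // permKV.
  rewrite (meet_at_fixV myx) // (meet_at_fix myz) // tpermD // 1?eq_sym //.
  by rewrite (neq y z) ?moved_step.
rewrite (_ : y^-1 t = t) ?(eqP xt); last by apply/eqP; rewrite perm_fixV.
have nyq : y q != t by apply: contraTneq yt => <-; rewrite moved_step.
have [zt|zt] := boolP (z t == t); last first.
  have [->|ztq] := eqVneq t (z q).
    rewrite permK tpermR (meet_at_fixV myx (t := y q)) ?moved_step //.
    by rewrite (meet_at_fix myz) ?moved_step.
  have zVt : z^-1 t != q by apply: contraNneq ztq => <-; rewrite permKV.
  rewrite (meet_at_fix mzy (t := z^-1 t)) ?moved_stepV //.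
  rewrite (meet_at_fixV mzx (t := z^-1 t)) ?moved_stepV // permKV.
  by rewrite tpermD // eq_sym.
have nzq : z q != t by apply: contraTneq zt => <-; rewrite moved_step.
rewrite (_ : z^-1 t = t); last by apply/eqP; rewrite perm_fixV.
rewrite (eqP yt) (_ : x^-1 t = t) ?(eqP zt) ?tpermD //.
by apply/eqP; rewrite perm_fixV.
Qed.

(** What a theta graph gives when the hole rests at one of its two branch vertices:
    [q] is the other one, each path contributes a cycle through [q], and [G] contains
    the closed walks that follow one path forwards and another one backwards. *)
Definition theta q x y z :=
  [/\ [/\ cycle_through q x, cycle_through q y & cycle_through q z],
      [/\ meet_at q x y, meet_at q x z & meet_at q y z] &
      [/\ x^-1 * y \in G, x^-1 * z \in G & y^-1 * z \in G]].

Definition theta_linked q x y z :=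
  {in porbit x q :|: porbit y q :|: porbit z q &, forall i j, linked G i j}.

Lemma theta_rot q x y z : theta q x y z -> theta q y z x.
Proof.
case=> [[cx cy cz] [mxy mxz myz] [gxy gxz gyz]]; split; split=> //; try exact: meet_at_sym.
  by rewrite -groupV invMg invgK.
by rewrite -groupV invMg invgK.
Qed.

Lemma theta_linked_rot q x y z : theta_linked q y z x -> theta_linked q x y z.
Proof.
move=> l i j iO jO; apply: l.
  by move: iO; rewrite !in_setU -orbA orbC.
by move: jO; rewrite !in_setU -orbA orbC.
Qed.

Lemma theta_spread q x y z i j k :
    theta q x y z -> z i != i -> i != q ->
    j \in porbit x q :|: porbit y q -> linked G j i ->
    k \in porbit x q :|: porbit y q -> k != q ->
  theta_linked q x y z.
Proof.
case=> [_ [mxy mxz myz] [gxy gxz gyz]] zi iq jO lji kO kq s t sO tO.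
have l := linked_spread mxy mxz myz gxy gxz gyz zi iq jO lji kO kq.
by apply: (linked_trans (l s sO)); rewrite linked_sym; apply: l.
Qed.

(** If [x] is trivial then [y] and [z] are in [G], and the commutator of two
    permutations whose supports share one point is a 3-cycle. *)
Lemma theta_chord q x y z :
  theta q x y z -> x q = q -> y q != q -> z q != q -> theta_linked q x y z.
Proof.
move=> th xq yq zq; have [[cx cy cz] [mxy mxz myz] [gxy gxz gyz]] := th.
have x1 : x = 1.
  apply/permP=> t; rewrite perm1; apply/eqP; apply: contraT => xt.
  have /porbitP[i ti] := cx t xt; case/eqP: xt.
  by rewrite ti -permM -expgSr expgS permM xq.
rewrite x1 invg1 mul1g in gxy.
rewrite x1 invg1 mul1g in gxz.
have mzy := meet_at_sym myz.
have zVq : z^-1 q != q by rewrite perm_fixV.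
have yVq : y^-1 q != q by rewrite perm_fixV.
have u : uniq [:: q; z q; y q].
  rewrite /= !inE negb_or !(eq_sym q) zq yq /= andbT.
  by apply: (contraNneq _ zq) => zy; apply/eqP/(myz (z q)); rewrite ?moved_step // zy moved_step.
have comm : y^-1 * z^-1 * y * z = cycle3 q (z q) (y q).
  apply/permP=> t; rewrite 3!permM.
  have [->|tq] := eqVneq t q.
    rewrite (meet_at_fixV myz (t := y^-1 q)) ?moved_stepV // permKV.
    by rewrite cycle3_1 //; move: u; rewrite /= !inE !negb_or => /and3P[/andP[]].
  have [->|tz] := eqVneq t (z q).
    rewrite (meet_at_fixV mzy (t := z q)) ?moved_step // permK cycle3_2.
    by rewrite (meet_at_fix myz (t := y q)) ?moved_step.
  have [->|ty] := eqVneq t (y q).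
    rewrite permK (meet_at_fix mzy (t := z^-1 q)) ?moved_stepV // permKV.
    by rewrite cycle3_3 //; move: u; rewrite /= !inE !negb_or => /and3P[/andP[]].
  rewrite cycle3D //; have [yt|yt] := boolP (y t == t); last first.
    have yVt : y^-1 t != q by apply: contraNneq ty => <-; rewrite permKV.
    by rewrite (meet_at_fixV myz (t := y^-1 t)) ?moved_stepV // permKV (meet_at_fix myz).
  rewrite (_ : y^-1 t = t); last by apply/eqP; rewrite perm_fixV.
  have [zt|zt] := boolP (z t == t).
    rewrite (_ : z^-1 t = t) ?(eqP yt) ?(eqP zt) //; by apply/eqP; rewrite perm_fixV.
  have zVt : z^-1 t != q by apply: contraNneq tz => <-; rewrite permKV.
  by rewrite (meet_at_fix mzy (t := z^-1 t)) ?moved_stepV // permKV.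
have g : cycle3 q (z q) (y q) \in G by rewrite -comm !groupM ?groupV.
apply: (@theta_spread _ _ _ _ (z q) q (y q)) => //; rewrite ?moved_step //.
- by rewrite inE porbit_id.
- exact: cycle3_linked u g.
- by rewrite in_setU orbC porbit_step ?porbit_id.
Qed.

(** Two transpositions sharing a point compose to a 3-cycle. *)
Lemma theta_short q x y z : theta q x y z ->
    y q != q -> y (y q) = q -> z q != q -> z (z q) = q ->
  theta_linked q x y z.
Proof.
move=> th yq yyq zq zzq; have [[cx cy cz] [mxy mxz myz] [gxy gxz gyz]] := th.
have tE w : cycle_through q w -> w (w q) = q -> w = tperm q (w q).
  move=> cw wwq; apply/permP=> t; have [->|tq] := eqVneq t q; first by rewrite tpermL.
  have [->|tw] := eqVneq t (w q); first by rewrite tpermR.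
  rewrite tpermD 1?eq_sym //; apply/eqP; apply: contraT => /cw /porbitP[n tE].
  suff: t = q \/ t = w q by case=> tE'; rewrite tE' eqxx in tq tw.
  rewrite {}tE; elim: n {tq tw} => [|n IH]; first by rewrite perm1; left.
  by rewrite expgSr permM; case: IH => ->; [right|left].
have g : cycle3 q (y q) (z q) \in G.
  by rewrite /cycle3 -(tE y) // -(tE z) //; move: gyz; rewrite {1}(tE y) // tpermV -tE.
have u : uniq [:: q; z q; y q].
  rewrite /= !inE negb_or !(eq_sym q) zq yq /= andbT.
  by apply: (contraNneq _ zq) => zy; apply/eqP/(myz (z q)); rewrite ?moved_step // zy moved_step.
apply: (@theta_spread _ _ _ _ (z q) q (y q)) => //; rewrite ?moved_step //.
- by rewrite inE porbit_id.
- apply: (cycle3_linked u); apply: (cycle3_sub _ g) => //.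
    by move: u; rewrite /= !inE !negb_or (eq_sym (z q)) => /and3P[/andP[-> ->] ->].
  by move=> t; rewrite !inE => /or3P[]->; rewrite ?orbT.
- by rewrite in_setU orbC porbit_step ?porbit_id.
Qed.

Lemma tperm_disjointC (a b c d : T) : a != c -> a != d -> b != c -> b != d ->
  tperm a b * tperm c d = tperm c d * tperm a b.
Proof.
by move=> ac ad bc bd; apply/commgP/conjg_fixP; rewrite tpermJ !tpermD // eq_sym.
Qed.

Lemma meet_at_neq q x y s t : meet_at q x y -> x s != s -> y t != t -> s != q -> s != t.
Proof. by move=> m xs yt sq; apply: contraNneq sq => st; rewrite (m s) // st. Qed.

Lemma meet_at_neq4 q x y : meet_at q x y -> x q != q -> y q != q ->
  [&& x q != y q, x q != y^-1 q, x^-1 q != y q & x^-1 q != y^-1 q].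
Proof.
move=> m xq yq; have xVq : x^-1 q != q by rewrite perm_fixV.
by apply/and4P; split; apply: (meet_at_neq m); rewrite ?moved_step ?moved_stepV.
Qed.

Lemma theta_double q x y z : theta q x y z -> x q != q -> y q != q -> z q != q ->
  tperm q (x^-1 q) * tperm (y q) (z q) \in G.
Proof.
case=> [_ [mxy mxz myz] [gxy gxz gyz]] xq yq zq.
rewrite -double_transposition // groupM // groupM // -groupV invMg invgK //.
Qed.

(** Conjugating one of the three double transpositions by another and multiplying
    by the third one cancels their common half; this gives the Klein group on [q]
    and its three predecessors. *)
Lemma theta_klein q x y z : theta q x y z ->
    x (x q) != q -> y (y q) != q -> z (z q) != q ->
  tperm q (x^-1 q) * tperm (y^-1 q) (z^-1 q) \in G.
Proof.
have nontriv (w : {perm T}) : w (w q) != q -> w q != q.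
  by apply: contraNneq => wq; rewrite !wq.
have opp (w : {perm T}) : w (w q) != q -> w q != w^-1 q.
  by apply: contraNneq => ->; rewrite permKV.
move=> th xxq yyq zzq; have [_ [mxy mxz myz] _] := th.
have [[xq yq] zq] := (nontriv _ xxq, nontriv _ yyq, nontriv _ zzq).
have dx := theta_double th xq yq zq.
have dy := theta_double (theta_rot th) yq zq xq.
have dz := theta_double (theta_rot (theta_rot th)) zq xq yq.
have := meet_at_neq4 mxy xq yq; have := meet_at_neq4 mxz xq zq.
have := meet_at_neq4 myz yq zq => /and4P[yz1 yz2 yz3 yz4] /and4P[xz1 xz2 xz3 xz4] /and4P[xy1 xy2 xy3 xy4].
have xVq : x^-1 q != q by rewrite perm_fixV.
have yVq : y^-1 q != q by rewrite perm_fixV.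
have zVq : z^-1 q != q by rewrite perm_fixV.
have [nx ny nz] : [/\ x q != x^-1 q, y q != y^-1 q & z q != z^-1 q] by split; apply: opp.
have := groupM dx (groupJ dz dy); rewrite conjMg !tpermJ !(permM (tperm q _)) tpermL.
tperm_fix (y^-1 q); do 2!tperm_fix (z^-1 q); tperm_fix (x q); rewrite tpermR.
do 2!tperm_fix (y q).
(* the common transposition of [y q] and [z q] cancels *)
rewrite (tpermC (z q)) -mulgA [X in _ * X]mulgA.
rewrite (tperm_disjointC (a := y q)); try neq_hyp.
by rewrite -!mulgA tperm2 mulg1.
Qed.

(** Two Klein groups sharing three points contain a 3-cycle. *)
Lemma theta_medium q x y z : theta q x y z ->
    x (x q) != q -> y (y q) != q -> z (z q) != q ->
  theta_linked q x y z.
Proof.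
move=> th xxq yyq zzq; have [_ [mxy mxz myz] [gxy _ _]] := th.
have nontriv (w : {perm T}) : w (w q) != q -> w q != q.
  by apply: contraNneq => wq; rewrite !wq.
have [[xq yq] zq] := (nontriv _ xxq, nontriv _ yyq, nontriv _ zzq).
have := meet_at_neq4 mxy xq yq => /and4P[_ _ _ xy].
have := meet_at_neq4 mxz xq zq => /and4P[_ _ _ xz].
have := meet_at_neq4 myz yq zq => /and4P[_ _ _ yz].
have xVq : x^-1 q != q by rewrite perm_fixV.
have yVq : y^-1 q != q by rewrite perm_fixV.
have zVq : z^-1 q != q by rewrite perm_fixV.
pose x2 := x^-1 (x^-1 q).
have x2q : x2 != q.
  by apply: contraNneq xxq => x2q; rewrite -{1}x2q /x2 !permKV.
have x2x : x x2 != x2 by rewrite /x2 permKV eq_sym (inj_eq perm_inj).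
have x2y : x2 != y^-1 q by apply: (meet_at_neq mxy); rewrite ?moved_stepV.
have x2z : x2 != z^-1 q by apply: (meet_at_neq mxz); rewrite ?moved_stepV.
have x2x1 : x2 != x^-1 q by rewrite /x2 (inj_eq perm_inj).
have v1 := theta_klein th xxq yyq zzq.
have v2 := theta_klein (theta_rot th) yyq zzq xxq.
have g : cycle3 (z^-1 q) (y^-1 q) x2 \in G.
  have := groupM v1 (groupJ v2 gxy); rewrite conjMg !tpermJ !permM.
  rewrite (meet_at_fix mxy (t := x^-1 q)) ?moved_stepV //.
  rewrite (meet_at_fixV (meet_at_sym mxy) (t := y^-1 q)) ?moved_stepV // permKV.
  rewrite (meet_at_fixV (meet_at_sym mxz) (t := z^-1 q)) ?moved_stepV //.
  rewrite (meet_at_fix (meet_at_sym myz) (t := z^-1 q)) ?moved_stepV //.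
  rewrite -/x2 (meet_at_fix mxy (t := x2)) // (tpermC (x^-1 q)).
  rewrite -mulgA [X in _ * X]mulgA (tperm_disjointC (a := y^-1 q)); try neq_hyp.
  by rewrite -[X in _ * X]mulgA mulgA tperm2 mul1g (tpermC (y^-1 q)).
have u : uniq [:: y^-1 q; z^-1 q; x2].
  by rewrite /= !inE negb_or yz !(eq_sym _ x2) x2y x2z.
apply: (@theta_spread _ _ _ _ (z^-1 q) (y^-1 q) (y^-1 q)) => //; rewrite ?moved_stepV //.
- by rewrite in_setU orbC porbit_stepV ?porbit_id.
- apply: (cycle3_linked u); apply: (cycle3_sub _ g) => //.
    by move: u; rewrite /= !inE !negb_or (eq_sym (y^-1 q) (z^-1 q)) => /and3P[/andP[-> ->] ->].
  by move=> t; rewrite !inE => /or3P[]->; rewrite ?orbT.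
- by rewrite in_setU orbC porbit_stepV ?porbit_id.
Qed.

(** When [x] and [y] are long enough, a shift by two along the glued cycle moves
    a double transposition so that it meets the original one in one point only. *)
Lemma theta_long q x y z : theta q x y z ->
    x (x q) != q -> x (x (x q)) != q -> y (y q) != q -> y (y (y q)) != q -> z q != q ->
  theta_linked q x y z.
Proof.
move=> th xxq xxxq yyq yyyq zq; have [_ [mxy mxz myz] [gxy _ _]] := th.
have nontriv (w : {perm T}) : w (w q) != q -> w q != q.
  by apply: contraNneq => wq; rewrite !wq.
have [xq yq] := (nontriv _ xxq, nontriv _ yyq).
have myx := meet_at_sym mxy; have mzx := meet_at_sym mxz; have mzy := meet_at_sym myz.
have xVq : x^-1 q != q by rewrite perm_fixV.
pose x2 := x^-1 (x^-1 q); pose x3 := x^-1 x2; pose y2 := y (y q); pose y3 := y y2.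
have x2q : x2 != q by apply: contraNneq xxq => x2q; rewrite -{1}x2q /x2 !permKV.
have x3q : x3 != q by apply: contraNneq xxxq => x3q; rewrite -{1}x3q /x3 /x2 !permKV.
have mx1 : x (x^-1 q) != x^-1 q by rewrite moved_stepV.
have mx2 : x x2 != x2 by rewrite /x2 !moved_stepV.
have mx3 : x x3 != x3 by rewrite /x3 moved_stepV.
have my1 : y (y q) != y q by rewrite moved_step.
have my2 : y y2 != y2 by rewrite /y2 moved_step.
have my3 : y y3 != y3 by rewrite /y3 moved_step.
have mz1 : z (z q) != z q by rewrite moved_step.
pose w := x^-1 * y; have wG2 : w ^+ 2 \in G by rewrite groupX.
have t1 := theta_double th xq yq zq; set t := _ * _ in t1.
have w2 s : (w ^+ 2) s = y (x^-1 (y (x^-1 s))) by rewrite expgS expg1 !permM.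
have t2 : tperm x2 x3 * tperm y3 (z q) \in G.
  have := groupJ t1 wG2; rewrite conjMg !tpermJ !w2.
  rewrite (meet_at_fix mxy (t := x^-1 q)) // -/x2 (meet_at_fix mxy (t := x2)) //.
  rewrite -/x3 (meet_at_fix mxy (t := x3)) //.
  rewrite (meet_at_fixV myx (t := y q)) // -/y2 (meet_at_fixV myx (t := y2)) // -/y3.
  rewrite (meet_at_fixV mzx (t := z q)) // (meet_at_fix mzy (t := z q)) //.
  by rewrite (meet_at_fixV mzx (t := z q)) // (meet_at_fix mzy (t := z q)).
have x12 : x^-1 q != x2 by rewrite eq_sym /x2 (inj_eq perm_inj).
have x13 : x^-1 q != x3 by rewrite /x3 (inj_eq perm_inj) eq_sym.
have y13 : y q != y3 by rewrite /y3 (inj_eq perm_inj) eq_sym.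
have x1y3 : x^-1 q != y3 by apply: (meet_at_neq mxy).
have x1z : x^-1 q != z q by apply: (meet_at_neq mxz).
have x2y1 : x2 != y q by apply: (meet_at_neq mxy).
have x2y3 : x2 != y3 by apply: (meet_at_neq mxy).
have x2z : x2 != z q by apply: (meet_at_neq mxz).
have x3y1 : x3 != y q by apply: (meet_at_neq mxy).
have x3y3 : x3 != y3 by apply: (meet_at_neq mxy).
have x3z : x3 != z q by apply: (meet_at_neq mxz).
have yz : y q != z q by apply: (meet_at_neq myz).
have y3z : y3 != z q by apply: (meet_at_neq myz).
have g : cycle3 y3 (y q) (z q) \in G.
  have := groupM (groupJ t2 t1) t2; rewrite conjMg !tpermJ.
  have -> : t x2 = x2 by rewrite permM; do 2!tperm_fix x2.
  have -> : t x3 = x3 by rewrite permM; do 2!tperm_fix x3.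
  have -> : t y3 = y3 by rewrite permM; do 2!tperm_fix y3.
  have -> : t (z q) = y q by rewrite permM; tperm_fix (z q); rewrite tpermR.
  rewrite -mulgA [X in _ * X]mulgA (tperm_disjointC (a := y3)); try neq_hyp.
  by rewrite -[X in _ * X]mulgA mulgA tperm2 mul1g.
have u : uniq [:: y q; z q; y3].
  by rewrite /= !inE negb_or yz y13 eq_sym y3z.
apply: (@theta_spread _ _ _ _ (z q) (y q) (y q)) => //.
- by rewrite in_setU orbC porbit_step ?porbit_id.
- apply: (cycle3_linked u); apply: (cycle3_sub _ g) => //.
    by rewrite /= !inE negb_or eq_sym y13 yz y3z.
  by move=> s; rewrite !inE => /or3P[]->; rewrite ?orbT.
- by rewrite in_setU orbC porbit_step ?porbit_id.
Qed.

End ThreeCyclesAtAPoint.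


(** * Sliding a hole along a graph *)

Section Sliding.
Variables (T : finType) (r : rel T).
Hypothesis r_sym : symmetric r.
Hypothesis r_irr : irreflexive r.
Implicit Types (h k t : T) (g : {perm T}) (s : seq T).

(** [g] records where everything is, [g h] being the position of the hole. *)
Definition slide h : rel {perm T} :=
  fun g g' => r (g h) (g' h) && (g' == g * tperm (g h) (g' h)).

Lemma slide_sym h : symmetric (slide h).
Proof.
suff H g g' : slide h g g' -> slide h g' g by move=> g g'; apply/idP/idP; apply: H.
case/andP=> rgg /eqP gE; rewrite /slide r_sym rgg /= tpermC.
by rewrite {1}gE -mulgA tperm2 mulg1.
Qed.

Lemma slide_mul h g a b : slide h (g * a) (g * b) = slide (g h) a b.
Proof. by rewrite /slide !permM -mulgA (inj_eq (mulgI g)). Qed.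

Lemma slide_connect_mul h g a b :
  connect (slide h) (g * a) (g * b) = connect (slide (g h)) a b.
Proof.
apply/idP/idP => c.
  rewrite -[b](mulKg g); move: c; set P := fun u => connect (slide (g h)) a (g^-1 * u) : Prop.
  apply: (connect_invariant P); rewrite /P ?mulKg ?connect0 // => u v Pu uv.
  by apply: (connect_trans1 Pu); rewrite -slide_mul !mulKVg.
move: c; apply: (connect_invariant (fun u => connect (slide h) (g * a) (g * u) : Prop)) => //.
by move=> u v Pu uv; apply: (connect_trans1 Pu); rewrite slide_mul.
Qed.

Definition reach h g := connect (slide h) 1 g.

Lemma reach1 h : reach h 1. Proof. exact: connect0. Qed.

Lemma reach_mul h g g' : reach h g -> reach (g h) g' -> reach h (g * g').
Proof.
by move=> hg hg'; apply: connect_trans hg _; rewrite -{1}[g]mulg1 slide_connect_mul.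
Qed.

Lemma reachV h g : reach h g -> reach (g h) g^-1.
Proof.
rewrite /reach -slide_connect_mul mulg1 mulgV.
by rewrite (sym_connect_sym (slide_sym h)).
Qed.

Definition puzzle_set h := [set g : {perm T} | (g h == h) && reach h g].

Lemma puzzle_group_set h : group_set (puzzle_set h).
Proof.
apply/group_setP; split=> [|a b]; first by rewrite inE perm1 eqxx reach1.
rewrite !inE permM => /andP[/eqP ah ra] /andP[/eqP bh rb].
by rewrite ah bh eqxx reach_mul ?ah.
Qed.

(** Wilson's puzzle group at [h]. *)
Canonical puzzle h := Group (puzzle_group_set h).

Lemma puzzleP h g : reflect (g h = h /\ reach h g) (g \in puzzle h).
Proof. by rewrite inE; apply: (iffP andP) => -[/eqP]. Qed.

Lemma puzzle_conj h w g : reach h w -> g \in puzzle h -> g ^ w \in puzzle (w h).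
Proof.
move=> hw /puzzleP[gh hg]; apply/puzzleP; split; first by rewrite conjgE !permM permK gh.
rewrite conjgE mulgA; apply: reach_mul; last by rewrite !permM permK gh.
by apply: reach_mul; rewrite ?permK //; apply: reachV.
Qed.

Lemma linked_transport h w i j :
  reach h w -> linked (puzzle h) i j -> linked (puzzle (w h)) (w i) (w j).
Proof.
move=> hw /linkedP[->|[k u gk]]; first exact: linked_refl.
apply: (@cycle3_linked _ _ _ _ (w k)); last by rewrite -cycle3J puzzle_conj.
by have := u; rewrite -(map_inj_uniq (@perm_inj _ w)).
Qed.

Fixpoint walk_perm h s : {perm T} :=
  if s is k :: s' then tperm h k * walk_perm k s' else 1.

Lemma walk_perm_last h s : walk_perm h s h = last h s.
Proof. by elim: s h => [|k s IH] h /=; rewrite ?perm1 // permM tpermL. Qed.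

Lemma walk_perm_cat h s1 s2 :
  walk_perm h (s1 ++ s2) = walk_perm h s1 * walk_perm (last h s1) s2.
Proof. by elim: s1 h => [|k s IH] h /=; rewrite ?mul1g // IH mulgA. Qed.

Lemma walk_perm_fix h s t : t \notin h :: s -> walk_perm h s t = t.
Proof.
elim: s h => [|k s IH] h /=; first by rewrite perm1.
rewrite !inE !negb_or permM => /and3P[th tk ts].
by rewrite tpermD 1?eq_sym // IH // inE negb_or tk.
Qed.

Lemma walk_perm_stable h s (K : {set T}) t :
  {subset h :: s <= K} -> t \in K -> walk_perm h s t \in K.
Proof.
elim: s h t => [|k s IH] h t sK tK /=; first by rewrite perm1.
have kK : k \in K by apply: sK; rewrite !inE eqxx orbT.
have hK : h \in K by apply: sK; rewrite !inE eqxx.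
rewrite permM; apply: IH => [u us|]; first by apply: sK; rewrite inE us orbT.
by case: tpermP => // ->.
Qed.

(** Only the first visit of the hole to [a] moves its occupant, to the place that
    the hole has just left. *)
Lemma walk_perm_shift h s1 a s2 :
  uniq (h :: s1 ++ a :: s2) -> walk_perm h (s1 ++ a :: s2) a = last h s1.
Proof.
rewrite -cat_cons cat_uniq => /and3P[_ dis _].
have nin t : t \in a :: s2 -> t \notin h :: s1 by move=> ts; apply: (hasPn dis).
rewrite walk_perm_cat permM (walk_perm_fix (nin a (mem_head _ _))) /= permM tpermR.
by rewrite walk_perm_fix //; apply: contraTN (mem_last h s1) => /nin.
Qed.

Lemma reach_walk h s : path r h s -> reach h (walk_perm h s).
Proof.
elim: s h => [|k s IH] h /=; first by move=> _; apply: reach1.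
case/andP=> rhk /IH rk; apply: reach_mul; last by rewrite tpermL.
by apply: connect1; rewrite /slide perm1 tpermL rhk mul1g eqxx.
Qed.

Lemma reach_parity (B : {set T}) h g :
    (forall x y, r x y -> (x \in B) != (y \in B)) -> reach h g ->
  odd_perm g = (h \in B) (+) (g h \in B).
Proof.
move=> rB; apply: (connect_invariant (fun g => odd_perm g = (h \in B) (+) (g h \in B))).
  by rewrite odd_perm1 perm1 addbb.
move=> u v uE /andP[ruv /eqP vE].
rewrite {1}vE odd_permM uE odd_tperm -addbA; congr addb.
have := rB _ _ ruv; case: (eqVneq (u h) (v h)) ruv => [->|_ _]; first by rewrite r_irr.
by case: (u h \in B); case: (v h \in B).
Qed.

(** * The puzzle group of a theta graph *)

(** The effect of the closed walk [v, s, v]. *)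
Definition rotation v s := walk_perm v s * tperm v (last v s).

Lemma rotation_hole v s : rotation v s v = v.
Proof. by rewrite permM walk_perm_last tpermR. Qed.

Lemma rotation_fix v s t : t \notin s -> rotation v s t = t.
Proof.
move=> ts; have [->|tv] := eqVneq t v; first exact: rotation_hole.
have out : t \notin v :: s by rewrite inE negb_or tv.
rewrite permM walk_perm_fix // tpermD // eq_sym //.
by apply: contraNneq out => ->; apply: mem_last.
Qed.

Lemma rotation_shift v s1 a b s2 :
  uniq (v :: s1 ++ a :: b :: s2) -> rotation v (s1 ++ a :: b :: s2) b = a.
Proof.
move=> u; rewrite /rotation permM -cat_rcons walk_perm_shift ?cat_rcons //.
rewrite last_rcons tpermD //.
  by move: u; rewrite cons_uniq mem_cat !inE eq_sym => /andP[/norP[_ /norP[]]].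
move: u; rewrite cons_uniq cat_uniq last_cat /= => /and4P[_ _ _].
by case/andP=> ab _; apply: contraNneq ab => <-; apply: mem_last.
Qed.

Lemma mem_split_seq (U : eqType) (x : U) (s : seq U) :
  x \in s -> exists p1 p2, s = p1 ++ x :: p2.
Proof. by case/splitPr=> p1 p2; exists p1, p2. Qed.

Lemma rotation_orbit v s a b :
  uniq (v :: s) -> a \in s -> b \in s -> b \in porbit (rotation v s) a.
Proof.
case: s => // c s u; set w := rotation _ _.
suff H t : t \in c :: s -> t \in porbit w c by move=> /H aO /H bO; apply: porbit_common bO aO.
case/mem_split_seq=> s1; elim/last_ind: s1 t => [|s1 d IH] t [s2 sE].
  by case: sE => <- _; apply: porbit_id.
rewrite cat_rcons in sE.
have /IH dO : exists s3, c :: s = s1 ++ d :: s3 by exists (t :: s2).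
suff <- : w^-1 d = t by apply: porbit_stepV.
by rewrite -[d](@rotation_shift v s1 d t s2) -?sE // permK.
Qed.

(** The inverse of the closed walk [v, A, u, v], as a cycle through [u]. With this
    choice [(arc v u A)^-1 * arc v u B] is the walk along [A] from [v] to [u] and
    back along [B]: the two direct moves between [u] and [v] cancel. *)
Definition arc v u (A : seq T) := (rotation v (rcons A u))^-1.

Lemma arc_fix v u A t : t \notin u :: A -> arc v u A t = t.
Proof.
move=> tA; apply/eqP; rewrite /arc perm_fixV rotation_fix //.
by rewrite mem_rcons.
Qed.

Lemma arc_orbit v u A : uniq (v :: rcons A u) -> {subset u :: A <= porbit (arc v u A) u}.
Proof.
by move=> uA t tA; rewrite porbitV rotation_orbit ?mem_rcons ?mem_head.
Qed.

Lemma arc_cycle v u A : uniq (v :: rcons A u) -> cycle_through u (arc v u A).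
Proof.
move=> uA t; apply: contraR => tO; rewrite arc_fix //.
by apply: contra tO; apply: arc_orbit.
Qed.

Lemma arc_meet v u A B : uniq (A ++ B) -> meet_at u (arc v u A) (arc v u B).
Proof.
rewrite cat_uniq => /and3P[_ /hasPn dis _] t At Bt; apply/eqP.
have /predU1P[->|tA] : t \in u :: A by apply: contraR At => /arc_fix->.
  by [].
have /predU1P[->|tB] : t \in u :: B by apply: contraR Bt => /arc_fix->.
  by [].
by case/negP: (dis t tB).
Qed.

Lemma arc_shift v u A1 a b A2 : uniq (v :: rcons (A1 ++ a :: b :: A2) u) ->
  arc v u (A1 ++ a :: b :: A2) a = b.
Proof.
move=> uA; rewrite /arc rcons_cat /=.
rewrite -{2}[a](@rotation_shift v A1 a b (rcons A2 u)) ?permK //.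
by rewrite -!rcons_cons -rcons_cat.
Qed.

Lemma arc_shift1 v u a A : uniq (v :: rcons (a :: A) u) -> arc v u (a :: A) u = a.
Proof.
move=> uA; apply: (canLR (permK _)).
rewrite /rotation permM (@walk_perm_shift v [::] a) //= tpermL.
by rewrite last_rcons.
Qed.

Lemma arc_nil v u : v != u -> arc v u [::] u = u.
Proof.
by move=> vu; apply: (canLR (permK _)); rewrite /rotation /= mulg1 tperm2 perm1.
Qed.

Lemma arc_reach v u A B :
    path r v (rcons A u) -> path r v (rcons B u) ->
  (arc v u A)^-1 * arc v u B \in puzzle v.
Proof.
move=> pA pB; rewrite /arc invgK /rotation !last_rcons invMg tpermV.
rewrite -mulgA [X in _ * X]mulgA tperm2 mul1g.
have last_walk s : walk_perm v (rcons s u) v = u by rewrite walk_perm_last last_rcons.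
apply/puzzleP; split.
  by rewrite permM last_walk; apply: (canLR (permK _)); rewrite last_walk.
apply: reach_mul; first exact: reach_walk.
by rewrite last_walk; have := reachV (reach_walk pB); rewrite last_walk.
Qed.

Lemma arc_last v u A b : uniq (v :: rcons (rcons A b) u) -> arc v u (rcons A b) b = u.
Proof.
move=> uA; apply: (canLR (permK _)); rewrite -cats1 cat_rcons.
by rewrite rotation_shift //; move: uA; rewrite -cats1 cat_rcons.
Qed.

Lemma arc_shape v u (A : seq T) (w := arc v u A) : uniq (v :: rcons A u) ->
  [/\ size A = 0 -> w u = u, size A = 1%N -> w (w u) = u, 0 < size A -> w u != u,
      1%N < size A -> w (w u) != u & 2 < size A -> w (w (w u)) != u].
Proof.
move=> uA.
have nu t : t \in A -> t != u.
  move=> tA; move: uA; rewrite /= rcons_uniq => /and3P[_ uA _].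
  by apply: contraNneq uA => <-.
rewrite /w {w}; case: A uA nu => [|a [|b [|c A]]] uA nu; split=> // _.
- by apply: arc_nil; move: uA; rewrite /= inE andbT.
- by rewrite arc_shift1 //; apply: (@arc_last v u [::]).
- by rewrite arc_shift1 // nu ?mem_head.
- by rewrite arc_shift1 // nu ?mem_head.
- by rewrite arc_shift1 // (@arc_shift v u [::]) // nu // !inE eqxx orbT.
- by rewrite arc_shift1 // nu ?mem_head.
- by rewrite arc_shift1 // (@arc_shift v u [::]) // nu // !inE eqxx orbT.
- rewrite arc_shift1 // (@arc_shift v u [::]) // (@arc_shift v u [:: a]) // nu //.
  by rewrite !inE eqxx !orbT.
Qed.

Local Ltac sizes oAB oAC AB AC BC := move: oAB oAC AB AC BC;
  repeat match goal with
  | H : is_true (0 < size _) |- _ => move: H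
  | H : size _ = 0 |- _ => move: H
  | H : size _ = 1%N |- _ => move: H
  | H : is_true (size _ != 1%N) |- _ => move: H
  end; clear; lia.

(** A bipartite theta graph has three paths of the same parity, which leaves four
    shapes up to the order of the paths. *)
Lemma arcs_linked v u (A B C : seq T) :
    uniq (v :: u :: A ++ B ++ C) ->
    path r v (rcons A u) -> path r v (rcons B u) -> path r v (rcons C u) ->
    odd (size A) = odd (size B) -> odd (size A) = odd (size C) ->
    0 < size A + size B -> 0 < size A + size C -> 0 < size B + size C ->
  {in u :: A ++ B ++ C &, forall i j, linked (puzzle v) i j}.
Proof.
move=> uT pA pB pC oAB oAC AB AC BC.
have [vu vT uT' uABC] : [/\ v != u, v \notin A ++ B ++ C, u \notin A ++ B ++ C & uniq (A ++ B ++ C)].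
  by move: uT; rewrite !cons_uniq inE negb_or => /and3P[/andP[-> ->] -> ->].
have sub_uniq D : {subset D <= A ++ B ++ C} -> uniq D -> uniq (v :: rcons D u).
  move=> sD uD; rewrite cons_uniq rcons_uniq uD mem_rcons inE (negPf vu) /=.
  by rewrite andbT; apply/andP; split; [apply: contra vT | apply: contra uT'] => /sD.
have [uA uB uC] : [/\ uniq (v :: rcons A u), uniq (v :: rcons B u) & uniq (v :: rcons C u)].
  have := uABC; rewrite !cat_uniq => /and3P[uA _ /and3P[uB _ uC]].
  by split; apply: sub_uniq => // t tD; rewrite !mem_cat tD ?orbT.
set x := arc v u A; set y := arc v u B; set z := arc v u C.
have th : theta (puzzle v) u x y z.
  split; split; [exact: arc_cycle| exact: arc_cycle| exact: arc_cycle| | | | | | ];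
    try by apply: arc_reach.
  - by apply: arc_meet; have := uABC; rewrite catA (cat_uniq (A ++ B)) => /and3P[].
  - apply: arc_meet; have := uABC; rewrite (perm_uniq (permEl (perm_catCA A B C))).
    by rewrite (cat_uniq B) => /and3P[].
  - by apply: arc_meet; have := uABC; rewrite (cat_uniq A) => /and3P[].
suff l : theta_linked (puzzle v) u x y z.
  move=> i j iT jT; apply: l.
    move: iT; rewrite -cat_cons !mem_cat !in_setU -orbA => /or3P[] iD.
    - by rewrite (arc_orbit uA).
    - by rewrite (arc_orbit uB) ?inE ?iD ?orbT.
    - by rewrite (arc_orbit uC) ?inE ?iD ?orbT.
  move: jT; rewrite -cat_cons !mem_cat !in_setU -orbA => /or3P[] jD.
  - by rewrite (arc_orbit uA).
  - by rewrite (arc_orbit uB) ?inE ?jD ?orbT.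
  - by rewrite (arc_orbit uC) ?inE ?jD ?orbT.
have [x0 x1 x2 x3 x4] := arc_shape uA.
have [y0 y1 y2 y3 y4] := arc_shape uB.
have [z0 z1 z2 z3 z4] := arc_shape uC.
have th2 := theta_rot th; have th3 := theta_rot th2.
have [a0|a0] := posnP (size A).
  by apply: (theta_chord th); [exact: x0|apply: y2|apply: z2]; sizes oAB oAC AB AC BC.
have [b0|b0] := posnP (size B).
  apply: theta_linked_rot.
  by apply: (theta_chord th2); [exact: y0|apply: z2|apply: x2]; sizes oAB oAC AB AC BC.
have [c0|c0] := posnP (size C).
  do 2!apply: theta_linked_rot.
  by apply: (theta_chord th3); [exact: z0|apply: x2|apply: y2]; sizes oAB oAC AB AC BC.
have [a1|a1] := eqVneq (size A) 1%N.
  have [b1|b1] := eqVneq (size B) 1%N.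
    do 2!apply: theta_linked_rot.
    by apply: (theta_short th3); [exact: x2|exact: x1|exact: y2|exact: y1].
  have [c1|c1] := eqVneq (size C) 1%N.
    apply: theta_linked_rot.
    by apply: (theta_short th2); [exact: z2|exact: z1|exact: x2|exact: x1].
  apply: theta_linked_rot.
  by apply: (theta_long th2); [apply: y3|apply: y4|apply: z3|apply: z4|apply: x2];
     sizes oAB oAC AB AC BC.
have [b1|b1] := eqVneq (size B) 1%N.
  have [c1|c1] := eqVneq (size C) 1%N.
    by apply: (theta_short th); [exact: y2|exact: y1|exact: z2|exact: z1].
  do 2!apply: theta_linked_rot.
  by apply: (theta_long th3); [apply: z3|apply: z4|apply: x3|apply: x4|apply: y2];
     sizes oAB oAC AB AC BC.
have [c1|c1] := eqVneq (size C) 1%N.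
  by apply: (theta_long th); [apply: x3|apply: x4|apply: y3|apply: y4|apply: z2];
     sizes oAB oAC AB AC BC.
by apply: (theta_medium th); [apply: x3|apply: y3|apply: z3]; sizes oAB oAC AB AC BC.
Qed.

End Sliding.


(** * Ears *)

Lemma connect_avoiding_path (T : finType) (S : {set T}) (e : rel T) x y :
    connect (avoiding S e) x y -> x \notin S ->
  exists s, [/\ path e x s, last x s = y, uniq (x :: s) & {in x :: s, forall t, t \notin S}].
Proof.
case/connectP=> s0 /shortenP[s ps us _] -> xS; exists s; split=> //.
  by apply: sub_path ps => a b /and3P[].
elim: s x ps xS {us} => [|b s IH] x /=; first by move=> _ xS t; rewrite inE => /eqP->.
case/andP=> /and3P[_ bS _] ps xS t; rewrite inE => /predU1P[->//|]; exact: IH.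
Qed.

Lemma path_connect_in (T : finType) (K : {set T}) (e : rel T) x s :
    path e x s -> {subset x :: s <= K} ->
  {in x :: s, forall t, connect (avoiding (~: K) e) x t}.
Proof.
elim: s x => [|b s IH] x /=; first by move=> _ _ t; rewrite inE => /eqP->; apply: connect0.
case/andP=> exb ps sK t; rewrite inE => /predU1P[->|ts]; first exact: connect0.
have bK : b \in K by apply: sK; rewrite !inE eqxx orbT.
apply: connect_trans (IH b ps _ t ts); last by move=> c cs; apply: sK; rewrite inE cs orbT.
by apply: connect1; rewrite /avoiding exb !inE bK !negbK sK ?mem_head.
Qed.

Lemma first_hit (T : eqType) (P : pred T) (s : seq T) :
  has P s -> exists s1 x s2, [/\ s = s1 ++ x :: s2, P x & {in s1, forall t, ~~ P t}].
Proof.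
elim: s => //= a s IH; case: (boolP (P a)) => Pa /=; first by exists [::], a, s.
case/IH=> s1 [x [s2 [-> Px s1P]]]; exists (a :: s1), x, s2; split=> // t.
by rewrite inE => /predU1P[->|/s1P].
Qed.

Section Wilson.
Variables (T : finType) (r : rel T) (V B : {set T}).
Hypothesis r_sym : symmetric r.
Hypothesis r_V : forall x y, r x y -> x \in V.
Hypothesis r_B : forall x y, r x y -> (x \in B) != (y \in B).
Hypothesis two_connected : forall x u v,
  u \in V :\ x -> v \in V :\ x -> connect (avoiding [set x] r) u v.
Implicit Types (K : {set T}) (h t : T) (s : seq T).

Lemma bip_irr : irreflexive r.
Proof. by move=> x; apply/negP => /r_B; rewrite eqxx. Qed.

Let pz := puzzle r.

Definition inner_connected K := {in K &, forall u v, connect (avoiding (~: K) r) u v}.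

Definition solvable_at h K := {in K :\ h &, forall i j, linked (pz h) i j}.

Lemma path_subset x s : x \in V -> path r x s -> {subset x :: s <= V}.
Proof.
elim: s x => [|b s IH] x xV /=; first by move=> _ t; rewrite inE => /eqP->.
case/andP=> rxb ps t; rewrite inE => /predU1P[->//|]; apply: IH => //.
by apply: (@r_V _ x); rewrite r_sym.
Qed.

(** Conjugation by a walk of the hole inside [K], which permutes [K]. *)
Lemma solvable_move K h k :
  inner_connected K -> h \in K -> k \in K -> solvable_at h K -> solvable_at k K.
Proof.
move=> cK hK kK sh i j /setD1P[ik iK] /setD1P[jk jK].
have hKc : h \notin ~: K by rewrite inE negbK.
have [s [ps ls _ sK]] := connect_avoiding_path (cK h k hK kK) hKc.
have sKs : {subset h :: s <= K} by move=> t /sK; rewrite inE negbK.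
have rw := reach_walk ps; set w := walk_perm h s in rw.
have wh : w h = k by rewrite walk_perm_last.
have wK t : t \in K -> w^-1 t \in K.
  have wKK : [set w x | x in K] \subset K.
    by apply/subsetP=> _ /imsetP[x xK ->]; apply: walk_perm_stable.
  have /eqP wKE : [set w x | x in K] == K by rewrite eqEcard wKK card_imset // ?leqnn; last exact: perm_inj.
  by rewrite -{1}wKE => /imsetP[x xK ->]; rewrite permK.
have wh' t : t != k -> w^-1 t != h by apply: contraNneq => wt; rewrite -wh -wt permKV.
by rewrite -[i](permKV w) -[j](permKV w) -wh; apply: linked_transport => //;
   apply: sh; rewrite !inE wh' ?wK.
Qed.

(** Shifting along the closed walk made of an ear and a return path inside [K]
    links the points of the ear one after the other, starting from its far end. *)
Lemma ear_solvable K p q E :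
    inner_connected K -> solvable_at p K -> 2 < #|K| ->
    p \in K -> q \in K -> q != p -> path r p (rcons E q) -> uniq E ->
    {in E, forall t, t \notin K} ->
  inner_connected (K :|: [set t in E]) /\ solvable_at p (K :|: [set t in E]).
Proof.
move=> cK sp K2 pK qK qp pE uE dE; set K' := K :|: _.
have KK' : {subset K <= K'} by move=> t tK; rewrite inE tK.
have EK' : {subset p :: rcons E q <= K'}.
  move=> t; rewrite inE mem_rcons inE => /or3P[/eqP->|/eqP->|tE].
  - exact: KK'.
  - exact: KK'.
  - by rewrite in_setU inE tE orbT.
split.
  have from_p t : t \in K' -> connect (avoiding (~: K') r) p t.
    rewrite !inE => /orP[tK|tE]; last first.
      by apply: (path_connect_in pE EK'); rewrite inE mem_rcons inE tE !orbT.
    apply: connect_mono (cK p t pK tK) => a b /and3P[]; rewrite !inE !negbK => aK bK rab.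
    by rewrite /avoiding rab !in_setC !negbK !KK'.
  move=> a b /from_p pa /from_p; apply: connect_trans.
  by rewrite (sym_connect_sym (avoiding_sym _ r_sym)).
have qKc : q \notin ~: K by rewrite inE negbK.
have [D [pD lD _ DK]] := connect_avoiding_path (cK q p qK pK) qKc.
have DKs : {subset q :: D <= K} by move=> t /DK; rewrite inE negbK.
pose w := walk_perm p (rcons E q ++ D).
have wE : w = walk_perm p (rcons E q) * walk_perm q D.
  by rewrite /w walk_perm_cat last_rcons.
have wG : w \in pz p.
  apply/puzzleP; split; first by rewrite /w walk_perm_last last_cat last_rcons.
  by apply: reach_walk; rewrite cat_path pE last_rcons.
have up : uniq (p :: rcons E q).
  rewrite cons_uniq rcons_uniq uE mem_rcons inE eq_sym (negPf qp) /= andbT.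
  by apply/andP; split; [apply/negP => /dE|apply/negP => /dE]; rewrite ?pK ?qK.
have w_shift E1 e f E2 : rcons E q = E1 ++ e :: f :: E2 -> e \in E -> w f = e.
  move=> EE eE; rewrite wE permM EE -cat_rcons walk_perm_shift ?last_rcons.
    by apply: walk_perm_fix; apply: contra (dE e eE) => /DKs.
  by rewrite cat_rcons -EE.
have [j jK] : exists j, j \in K :\: [set p; q].
  apply/set0Pn; rewrite -card_gt0 cardsD.
  have := subset_leq_card (subsetIr K [set p; q]); rewrite cards2; move: K2; clear; case: (_ != _); lia.
have [jp jq jK'] : [/\ j != p, j != q & j \in K].
  by move: jK; rewrite !inE negb_or => /andP[/andP[-> ->] ->].
have wjK : w j \in K :\ p.
  have jE : walk_perm p (rcons E q) j = j.
    apply: walk_perm_fix; rewrite inE mem_rcons inE !negb_or jp jq.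
    by apply/negP => /dE; rewrite jK'.
  rewrite wE permM jE inE (walk_perm_stable DKs) // inE andbT.
  apply: (contraNneq _ jq) => wjp.
  by rewrite -(inj_eq (@perm_inj _ (walk_perm q D))) wjp walk_perm_last lD.
pose L t := {in K :\ p, forall k, linked (pz p) t k}.
have LK t : t \in K :\ p -> L t by move=> tK k; apply: sp.
have L_step e f : w f = e -> L f -> L e.
  move=> <- Lf k kK; apply: (linked_trans (j := w j)); last exact: LK.
  by apply: linked_perm => //; apply: Lf; rewrite !inE jp.
have LE E2 E1 : E = E1 ++ E2 -> {in E2, forall t, L t}.
  elim: E2 E1 => // e E2 IH E1 EE.
  have IH' : {in E2, forall t, L t} by apply: (IH (rcons E1 e)); rewrite cat_rcons.
  have eE : e \in E by rewrite EE mem_cat mem_head orbT.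
  move=> t; rewrite inE => /predU1P[->|]; last exact: IH'.
  case: E2 EE IH' {IH} => [|f E2] EE IH'.
    apply: (L_step e q); last by apply: LK; rewrite !inE qp.
    by apply: (w_shift E1 e q [::]); rewrite // EE rcons_cat.
  apply: (L_step e f); last by apply: IH'; rewrite mem_head.
  by apply: (w_shift E1 e f (rcons E2 q)); rewrite // EE rcons_cat.
have LK' t : t \in K' :\ p -> L t.
  rewrite in_setD1 in_setU inE => /andP[tp /orP[tK|tE]]; first by apply: LK; rewrite !inE tp.
  exact: (LE E [::]).
move=> a b /LK' La /LK' Lb; apply: (linked_trans (La _ wjK)).
by rewrite linked_sym; apply: Lb.
Qed.

Lemma path_parity h s : path r h s ->
  odd (size s) = (h \in B) (+) (last h s \in B).
Proof.
elim: s h => [|k s IH] h /=; first by rewrite addbb.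
case/andP=> /r_B hk /IH->; move: hk.
by case: (h \in B); case: (k \in B); case: (_ \in B).
Qed.

(** Three neighbours of [v] lie on a theta graph: a cycle through two of them,
    and a path from the third one to that cycle, all avoiding [v]. *)
Lemma exists_theta v h1 h2 h3 :
    r v h1 -> r v h2 -> r v h3 -> uniq [:: h1; h2; h3] ->
  exists K, [/\ 2 < #|K|, K \subset V, inner_connected K & exists2 h, h \in K & solvable_at h K].
Proof.
move=> r1 r2 r3; rewrite /= !inE negb_or => /andP[/andP[n12 n13] /andP[n23 _]].
have vV := r_V r1.
have nbV h : r v h -> h \in V :\ v.
  move=> rh; rewrite !inE (@r_V h v) 1?r_sym // andbT.
  by apply: contraTneq rh => ->; rewrite bip_irr.
have nbv h : r v h -> h \notin [set v] by move=> /nbV /setD1P[]; rewrite inE.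
have [s [ps ls us sv]] := connect_avoiding_path (two_connected (nbV _ r1) (nbV _ r2)) (nbv _ r1).
have [s' [ps' ls' us' sv']] :=
  connect_avoiding_path (two_connected (nbV _ r3) (nbV _ r1)) (nbv _ r3).
have [C [u [C' [CE /= uS C_out]]]] : exists s1 x s2, [/\ h3 :: s' = s1 ++ x :: s2,
    x \in h1 :: s & {in s1, forall t, t \notin h1 :: s}].
  by apply: (@first_hit _ (mem (h1 :: s))); apply/hasP; exists h1; rewrite -?ls' ?mem_last //=
     ?ls' ?mem_head.
have [A [B' AE]] := mem_split_seq uS.
pose Br := rev B'.
have pA : path r v (rcons A u).
  have : path r v (h1 :: s) by rewrite /= r1.
  by rewrite AE -cat_rcons cat_path => /andP[].
have pC : path r v (rcons C u).
  have : path r v (h3 :: s') by rewrite /= r3.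
  by rewrite CE -cat_rcons cat_path => /andP[].
have lB : last u B' = h2.
  by rewrite -ls -[last h1 s]/(last v (h1 :: s)) AE last_cat.
have pB : path r v (rcons Br u).
  have pB' : path r u (rcons B' v).
    rewrite rcons_path lB r_sym r2 andbT.
    have : path r v (h1 :: s) by rewrite /= r1.
    by rewrite AE cat_path /= => /and3P[].
  have := rev_path r u (rcons B' v); rewrite last_rcons belast_rcons rev_cons => ->.
  by apply: sub_path pB' => a b; rewrite r_sym.
have vS t : t \in h1 :: s -> t != v by move/sv; rewrite inE.
have vC t : t \in C -> t != v.
  by move=> tC; have := sv' t; rewrite CE mem_cat tC inE => /(_ isT).
have u3 : uniq (A ++ u :: B') by rewrite -AE.
have uC : uniq C by move: us'; rewrite CE cat_uniq => /andP[].
have dis : {in C, forall t, t \notin A ++ u :: B'} by move=> t /C_out; rewrite AE.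
have uAll : uniq (v :: u :: A ++ Br ++ C).
  have perm : perm_eq (u :: A ++ Br ++ C) ((A ++ u :: B') ++ C).
    by apply/seq.permP => a; rewrite /= !count_cat /= !count_rev addnCA -!addnA.
  rewrite cons_uniq (perm_uniq perm) (perm_mem perm) cat_uniq u3 uC andbT /=.
  apply/andP; split.
    rewrite mem_cat negb_or -AE; apply/andP; split.
      by apply/negP => /vS; rewrite eqxx.
    by apply/negP => /vC; rewrite eqxx.
  by apply/hasPn.
pose K := [set t in v :: u :: A ++ Br ++ C].
have KE t : (t \in K) = (t \in v :: u :: A ++ Br ++ C) by rewrite inE.
have sub s0 : {subset s0 <= A ++ Br ++ C} -> {subset v :: rcons s0 u <= K}.
  move=> s0K t; rewrite KE inE mem_rcons !inE => /or3P[->|->|/s0K->]; by rewrite ?orbT.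
have cA : {subset A <= A ++ Br ++ C} by move=> t tA; rewrite mem_cat tA.
have cB : {subset Br <= A ++ Br ++ C} by move=> t tA; rewrite !mem_cat tA orbT.
have cC : {subset C <= A ++ Br ++ C} by move=> t tA; rewrite !mem_cat tA !orbT.
have par s0 : path r v (rcons s0 u) -> odd (size s0) = ~~ ((v \in B) (+) (u \in B)).
  by move/path_parity; rewrite size_rcons last_rcons /= => <-; rewrite negbK.
have A0 : A = [::] -> u = h1 by move=> A0; move: AE; rewrite A0 => -[->].
have C0 : C = [::] -> u = h3 by move=> C0; move: CE; rewrite C0 => -[->].
have B0 : B' = [::] -> u = h2 by move=> B0; move: lB; rewrite B0.
have sz (D : seq T) : (size D == 0) = (D == [::]) by case: D.
have ltAB : 0 < size A + size Br.
  rewrite lt0n addn_eq0 size_rev !sz; apply/negP => /andP[/eqP/A0 E1 /eqP/B0 E2].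
  by move: n12; rewrite -E1 -E2 eqxx.
have ltAC : 0 < size A + size C.
  rewrite lt0n addn_eq0 !sz; apply/negP => /andP[/eqP/A0 E1 /eqP/C0 E2].
  by move: n13; rewrite -E1 -E2 eqxx.
have ltBC : 0 < size Br + size C.
  rewrite lt0n addn_eq0 size_rev !sz; apply/negP => /andP[/eqP/B0 E1 /eqP/C0 E2].
  by move: n23; rewrite -E1 -E2 eqxx.
have cardK : #|K| = (size A + size Br + size C).+2.
  by rewrite cardsE (card_uniqP uAll) /= !size_cat addnA.
have sKV s0 : path r v (rcons s0 u) -> {subset s0 <= V}.
  by move=> p0 t t0; apply: (path_subset vV p0); rewrite inE mem_rcons inE t0 !orbT.
exists K; split.
- by rewrite cardK !ltnS addn_gt0 ltAB.
- apply/subsetP=> t; rewrite KE 2!inE !mem_cat => /or3P[/eqP->//|/eqP->|/or3P[]].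
  + by apply: (path_subset vV pA); rewrite inE mem_rcons mem_head orbT.
  + exact: sKV pA _.
  + exact: sKV pB _.
  + exact: sKV pC _.
- have from_v t : t \in K -> connect (avoiding (~: K) r) v t.
    rewrite KE 2!inE !mem_cat => /or3P[/eqP->|/eqP->|/or3P[] tD]; first exact: connect0.
    + by apply: (path_connect_in pA (sub _ cA)); rewrite inE mem_rcons mem_head orbT.
    + by apply: (path_connect_in pA (sub _ cA)); rewrite inE mem_rcons inE tD !orbT.
    + by apply: (path_connect_in pB (sub _ cB)); rewrite inE mem_rcons inE tD !orbT.
    + by apply: (path_connect_in pC (sub _ cC)); rewrite inE mem_rcons inE tD !orbT.
  move=> a b /from_v pa /from_v; apply: connect_trans.
  by rewrite (sym_connect_sym (avoiding_sym _ r_sym)).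
- exists v; first by rewrite KE mem_head.
  move=> i j; rewrite !in_setD1 !KE !(in_cons v) => /andP[/negPf-> iK] /andP[/negPf-> jK].
  by apply: (arcs_linked r_sym uAll pA pB pC) => //; rewrite !par.
Qed.

(** An edge leaving [K] extends to an ear, because the graph stays connected when
    the end of this edge in [K] is deleted. *)
Lemma grow_solvable K :
    2 < #|K| -> K \subset V -> inner_connected K -> (exists2 h, h \in K & solvable_at h K) ->
  forall h, h \in V -> solvable_at h V.
Proof.
have [n] := ubnP #|V :\: K|; elim: n K => // n IH K; rewrite ltnS => szK K2 KV cK sK h hV.
have {}sK h' : h' \in K -> solvable_at h' K.
  by move=> h'K; have [k kK] := sK; apply: solvable_move.
have [VK|nVK] := boolP (V \subset K).
  have KE : K = V by apply/eqP; rewrite eqEsubset KV.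
  by rewrite -KE; apply: sK; rewrite KE.
have [x0 x0V x0K] := subsetPn nVK.
have [p0 p0K] : exists p0, p0 \in K by apply/set0Pn; rewrite -card_gt0 (leq_trans _ K2).
have p0x0 : p0 != x0 by apply: contraNneq x0K => <-.
have [/existsP[p /existsP[x /and3P[pK xK rpx]]]|closed] :=
  boolP [exists p, exists x, [&& p \in K, x \notin K & r p x]]; last first.
  have closedK a b : a \in K -> r a b -> b \in K.
    move=> aK rab; apply: contraR closed => bK.
    by apply/existsP; exists a; apply/existsP; exists b; rewrite aK bK.
  have [a aK] : exists a, a \in K :\ p0.
    by apply/set0Pn; rewrite -card_gt0; have := cardsD1 p0 K; rewrite p0K; move: K2; clear; lia.
  have [aa ap] := setD1P aK.
  have := @two_connected p0 a x0; rewrite !inE aa (subsetP KV) // [x0 == _]eq_sym p0x0 x0V.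
  move=> /(_ isT isT) c; case/negP: x0K.
  apply: (connect_invariant (fun t => t \in K : Prop) _ _ c) => // s t sK' /and3P[_ _].
  exact: closedK.
have [a /setD1P[ap aK]] : exists a, a \in K :\ p.
  by apply/set0Pn; rewrite -card_gt0; have := cardsD1 p K; rewrite pK; move: K2; clear; lia.
have xV : x \in V by apply: (@r_V x p); rewrite r_sym.
have xp : x != p by apply: contraNneq xK => ->.
have xp' : x \notin [set p] by rewrite inE.
have cxa : connect (avoiding [set p] r) x a.
  by apply: two_connected; rewrite !inE ?xp ?ap ?xV ?(subsetP KV).
have [s [ps ls us sp]] := connect_avoiding_path cxa xp'.
have [E [q [E' [EE qK E_out]]]] : exists s1 y s2, [/\ x :: s = s1 ++ y :: s2,
    y \in K & {in s1, forall t, t \notin K}].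
  by apply: (@first_hit _ (mem K)); apply/hasP; exists a; rewrite // -ls mem_last.
have pE : path r p (rcons E q).
  have : path r p (x :: s) by rewrite /= rpx.
  by rewrite EE -cat_rcons cat_path => /andP[].
have uE : uniq E by move: us; rewrite EE cat_uniq => /andP[].
have qp : q != p by have := sp q; rewrite EE mem_cat mem_head orbT inE => /(_ isT).
have [cK' sK'] := ear_solvable cK (sK p pK) K2 pK qK qp pE uE E_out.
have xE : x \in E.
  by case: (E) EE => [|e E0] [xE _]; [move: xK; rewrite xE qK|rewrite xE mem_head].
apply: (IH (K :|: [set t in E])) => //.
- apply: leq_trans szK; apply: proper_card; apply/properP; split.
    by apply: setDS; apply: subsetUl.
  by exists x; rewrite !inE ?xE ?orbT ?xK.
- by apply: leq_trans K2 _; apply/subset_leq_card/subsetUl.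
- rewrite subUset KV; apply/subsetP=> t; rewrite inE => tE.
  by apply: (path_subset (subsetP KV _ pK) pE); rewrite inE mem_rcons inE tE !orbT.
- by exists p; rewrite // in_setU pK.
Qed.

(** Wilson's theorem for bipartite graphs: closed walks realise all even permutations,
    and composing with a walk from [h] to [g h] reduces to this case. *)
Theorem wilson v h1 h2 h3 h g :
    r v h1 -> r v h2 -> r v h3 -> uniq [:: h1; h2; h3] ->
    h \in V -> perm_on V g -> odd_perm g = (h \in B) (+) (g h \in B) ->
  reach r h g.
Proof.
move=> r1 r2 r3 u hV gV par.
have [K [K2 KV cK sK]] := exists_theta r1 r2 r3 u.
have sV := grow_solvable K2 KV cK sK.
have even k g' : k \in V -> perm_on (V :\ k) g' -> odd_perm g' = false -> g' \in pz k.
  by move=> kV; apply/cycle3_even/linked_cycle3/sV.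
have ghV : g h \in V by rewrite perm_closed.
have [w rw wh] : exists2 w, reach r h w & w h = g h.
  have [E|nE] := eqVneq (g h) h; first by exists 1; rewrite ?reach1 ?perm1.
  have [x xV] : exists x, x \in V :\: [set h; g h].
    apply/set0Pn; rewrite -card_gt0; have := subset_leq_card KV.
    have := cardsID [set h; g h] V; have := subset_leq_card (subsetIr V [set h; g h]).
    by rewrite cards2; move: K2; clear; case: (_ != _); lia.
  have [xh xg xV'] : [/\ x != h, x != g h & x \in V].
    by move: xV; rewrite !inE negb_or => /andP[/andP[-> ->] ->].
  have hx : h \notin [set x] by rewrite inE eq_sym.
  have c : connect (avoiding [set x] r) h (g h).
    by apply: two_connected; apply/setD1P; split; rewrite // eq_sym.
  have [s [ps ls _ _]] := connect_avoiding_path c hx.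
  by exists (walk_perm h s); [apply: reach_walk|rewrite walk_perm_last].
have wV : perm_on V w.
  move: rw; apply: (connect_invariant (fun u => perm_on V u)); first exact: perm_on1.
  move=> a b aV /andP[rab /eqP->]; apply: perm_onM => //; apply/subsetP=> t.
  rewrite inE; case: tpermP => [->|->|_ _]; rewrite ?eqxx // => _.
    exact: r_V rab.
  by apply: (@r_V _ (a h)); rewrite r_sym.
have odd_w := reach_parity bip_irr r_B rw.
have gw : g * w^-1 \in pz h.
  apply: even => //; last by rewrite odd_permM odd_permV odd_w par wh addbb.
  apply/subsetP=> t; rewrite !inE; apply: contraR; rewrite negb_and negbK.
  case/orP=> [/eqP->|tV]; first by rewrite permM -wh permK.
  by rewrite permM (out_perm gV) // -{1}(out_perm wV tV) permK.
have /puzzleP[gwh rgw] := gw.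
by rewrite -[g](mulgKV w); apply: reach_mul => //; rewrite gwh.
Qed.

End Wilson.


(** * Deleting states of the sliding puzzle *)

Lemma rotation_pow_fix (T : finType) (v a : T) s i :
  uniq (v :: s) -> a \in s -> (rotation v s ^+ i) a = a -> rotation v s ^+ i = 1.
Proof.
move=> us as_ fix_a; set c := rotation v s in fix_a *.
apply/permP=> t; rewrite perm1; have [ts|ts] := boolP (t \in s).
  have /porbitP[n ->] := rotation_orbit us as_ ts.
  by rewrite -permM -expgD addnC expgD permM fix_a.
have ct : c t = t by apply: rotation_fix.
by elim: i {fix_a} => [|i IH]; rewrite ?perm1 // expgSr permM IH.
Qed.

Section StarPuzzle.
Variables (T : finType) (r : rel T) (V B : {set T}) (m : nat).
Hypothesis r_sym : symmetric r.
Hypothesis r_V : forall x y, r x y -> x \in V.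
Hypothesis r_B : forall x y, r x y -> (x \in B) != (y \in B).
Hypothesis m_connected : forall (S : {set T}) u v, #|S| < m ->
  u \in V :\: S -> v \in V :\: S -> connect (avoiding S r) u v.

Implicit Types (w z u v p q : {perm T}) (S : {set {perm T}}) (c : T).

(** Two neighbours of a deleted state [w] differ from it by moving the hole to
    [h1] or to [h2]. Rotating a cycle through these two positions and the hole
    joins them. The cycle is chosen to avoid, for each deleted [z] that disagrees
    with [w] elsewhere, one position of disagreement. The other deleted states are
    not met either, since on the way only [u], [v] and [w] agree with [w] outside
    the three positions. *)
Lemma slide_detour S c w u v :
    #|S| < m -> w \in S -> u \notin S -> v \notin S -> slide r c u w -> slide r c w v ->
  connect (avoiding S (slide r c)) u v.
Proof.
move=> Sm wS uS vS uw /andP[]; set H := w c; set h2 := v c => rh2 /eqP vE.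
rewrite slide_sym // in uw; case/andP: uw; rewrite -/H; set h1 := u c => rh1 /eqP uE.
have [h12|h12] := eqVneq h1 h2; first by rewrite uE vE h12 connect0.
have r_irr := bip_irr r_B.
have nH h : r H h -> h != H by apply: contraTneq => ->; rewrite r_irr.
pose f z := odflt H [pick p | (p \notin [:: H; h1; h2]) && (z^-1 p != w^-1 p)].
have fw : f w = H by rewrite /f; case: pickP => //= p /andP[_]; rewrite eqxx.
pose S0 := [set f z | z in S].
have S0m : #|S0| < m by apply: leq_ltn_trans (leq_imset_card _ _) Sm.
have HS0 : H \in S0 by rewrite -fw imset_f.
have outS0 h : h \in [:: h1; h2] -> r H h -> h \in V :\: S0.
  move=> hh rh; rewrite inE (@r_V h H) 1?r_sym // andbT.
  apply/imsetP=> -[z _]; rewrite /f; case: pickP => /= [p /andP[pn _] hp|_ hH].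
    by move: pn; rewrite inE -hp hh orbT.
  by move: (nH h rh); rewrite hH eqxx.
have h1V := outS0 _ (mem_head _ _) rh1.
have h2V : h2 \in V :\: S0 by apply: outS0; rewrite // !inE eqxx orbT.
have h1S0 : h1 \notin S0 by case/setDP: h1V.
have [s0 [ps ls us sS0]] := connect_avoiding_path (m_connected S0m h1V h2V) h1S0.
case: s0 ps ls us sS0 => [|k s0] ps ls us sS0; first by rewrite /= in ls; rewrite ls eqxx in h12.
set s := [:: h1, k & s0] in us sS0.
have uHs : uniq (H :: s).
  by rewrite cons_uniq us andbT; apply/negP => /sS0; rewrite HS0.
have ks : k \in s by rewrite !inE eqxx orbT.
have kH : k != H by apply: contraNneq (sS0 k ks) => ->.
have kh1 : k != h1.
  by move: us; rewrite /= inE negb_or eq_sym => /andP[/andP[]].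
have kh2 : k != h2.
  have rh1k : r h1 k by case/andP: ps.
  apply: contraTneq (r_B rh1k) => ->; move: (r_B rh1) (r_B rh2).
  by case: (H \in B); case: (h1 \in B); case: (h2 \in B).
have lasts : last H s = h2 by rewrite /= -ls.
have pathH : path r H s by rewrite /= rh1.
pose rot := rotation H s.
have notin p : (forall t, t \notin H :: s -> p t = t) ->
    [|| p H \notin [:: H; h1; h2], p k != k, p == tperm H h1 | p == tperm H h2] ->
    w * p \notin S.
  move=> p_fix p_far; apply/negP => zS; set z := w * p in zS.
  have zp t : p t = t -> z^-1 t = w^-1 t.
    by move=> pt; rewrite invMg permM -{1}pt permK.
  have agree t : t \notin [:: H; h1; h2] -> p t = t.
    move=> tn; have : f z \in S0 by apply: imset_f.
    rewrite /f; case: pickP => /= [t' /andP[t'n zt'] t'S0|/(_ t) none _].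
      case/eqP: zt'; apply/zp/p_fix; rewrite inE negb_or.
      rewrite (_ : t' != H) /=; first by apply: contraL t'S0 => /sS0.
      by move: t'n; rewrite inE negb_or => /andP[].
    move: none; rewrite tn /= => /negbFE/eqP; rewrite invMg permM => /perm_inj pt.
    by rewrite -{1}pt permKV.
  case/or4P: p_far.
  - by move=> pH; have /perm_inj E := agree _ pH; move: pH; rewrite E mem_head.
  - by rewrite agree ?eqxx // !inE !negb_or kH kh1 kh2.
  - by move/eqP=> pE; case/negP: uS; rewrite uE -pE.
  - by move/eqP=> pE; case/negP: vS; rewrite vE -pE.
have rotH i : (rot ^+ i) H = H.
  by elim: i => [|i IH]; rewrite ?perm1 // expgSr permM IH rotation_hole.
have rot_fix i t : t \notin H :: s -> (rot ^+ i) t = t.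
  rewrite inE negb_or => /andP[_ ts]; elim: i => [|i IH]; rewrite ?perm1 // expgSr permM IH.
  exact: rotation_fix.
have rot_step i : rot ^+ i * walk_perm H s = rot ^+ i.+1 * tperm H h2.
  have -> : walk_perm H s = rot * tperm H h2 by rewrite /rot /rotation lasts -mulgA tperm2 mulg1.
  by rewrite expgSr mulgA.
have hs : {subset [:: H; h1; h2] <= H :: s}.
  move=> t; rewrite !inE => /or3P[->|->|/eqP->]; rewrite ?orbT //.
  by rewrite -!in_cons -lasts mem_last.
(* the hole stands at [h1] or [h2] after some rounds *)
have notin_tperm i h : h \in [:: h1; h2] -> w * (rot ^+ i * tperm H h) \notin S.
  move=> hh; have ht : h \in H :: s by apply: hs; rewrite inE hh orbT.
  have kh : h != k by move: hh; rewrite !inE => /orP[]/eqP->; rewrite eq_sym.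
  apply: notin => [t tn|].
    rewrite permM rot_fix // tpermD //; first by apply: contraNneq tn => <-; apply: mem_head.
    by apply: contraNneq tn => <-.
  have [fix_k|nfix] := eqVneq ((rot ^+ i) k) k.
    rewrite (rotation_pow_fix uHs ks fix_k) mul1g.
    by move: hh; rewrite !inE => /orP[]/eqP->; rewrite eqxx !orbT.
  rewrite (_ : _ k != k) ?orbT // permM; apply: contraNneq nfix => E.
  by rewrite -(inj_eq (@perm_inj _ (tperm H h))) E tpermD // eq_sym.
have notin_walk i s1 s2 : s1 != [::] -> s = s1 ++ s2 -> w * (rot ^+ i * walk_perm H s1) \notin S.
  case: s1 => [//|a [|b s1]] _ sE.
    by case: sE => <- _; rewrite /= mulg1; apply: notin_tperm; apply: mem_head.
  case: s2 sE => [|d s2] sE.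
    by rewrite cats0 in sE; rewrite -sE rot_step; apply: notin_tperm; rewrite !inE eqxx orbT.
  apply: notin => [t tn|].
    rewrite permM rot_fix // walk_perm_fix //; apply: contra tn.
    by rewrite sE !(in_cons H) mem_cat => /orP[->//|->]; rewrite orbT.
  rewrite permM rotH walk_perm_last; apply/orP; left.
  set l := last H _; have ls1 : l \in b :: s1 by rewrite /l /=; apply: mem_last.
  have := uHs; rewrite sE -cat_cons cat_uniq => /and3P[us1 dis _].
  rewrite !inE !negb_or; apply/and3P; split.
  - by apply: contraTneq us1 => <-; rewrite cons_uniq in_cons ls1 orbT.
  - have <- : a = h1 by case: sE.
    by apply: contraTneq us1 => <-; rewrite 2!cons_uniq ls1 andbF.
  - have h2E : h2 \in d :: s2 by rewrite -lasts sE last_cat /=; apply: mem_last.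
    apply: contra dis => /eqP lh2; apply/hasP; exists h2 => //=.
    by rewrite -lh2 !inE; move: ls1; rewrite inE => ->; rewrite !orbT.
have step p q : w * p \notin S -> w * q \notin S -> r (p H) (q H) -> q = p * tperm (p H) (q H) ->
    avoiding S (slide r c) (w * p) (w * q).
  by move=> pS qS rpq qE; rewrite /avoiding pS qS slide_mul /slide rpq -qE eqxx.
have walk i s2 s1 : s1 != [::] -> s = s1 ++ s2 ->
    connect (avoiding S (slide r c)) (w * (rot ^+ i * walk_perm H s1))
                                     (w * (rot ^+ i * walk_perm H s)).
  elim: s2 s1 => [|b s2 IH] s1 s1n sE; first by rewrite sE cats0 connect0.
  apply: connect_trans (IH (rcons s1 b) _ _); last by rewrite cat_rcons.
    have sE' : s = rcons s1 b ++ s2 by rewrite cat_rcons.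
    apply: connect1; apply: step; rewrite ?(notin_walk _ _ _ _ sE) ?(notin_walk _ _ _ _ sE') //.
    - by case: (s1).
    - rewrite !permM rotH !walk_perm_last last_rcons.
      by move: pathH; rewrite sE cat_path /= => /and3P[].
    - rewrite !permM rotH !walk_perm_last last_rcons -cats1 walk_perm_cat /= mulg1.
      by rewrite mulgA.
  by case: (s1).
have round i : i < #[rot] ->
    connect (avoiding S (slide r c)) u (w * (rot ^+ i * tperm H h1)).
  elim: i => [|i IH] iN; first by rewrite mul1g -uE connect0.
  have := IH (ltnW iN) => c1; apply: connect_trans c1 _.
  have := walk i (k :: s0) [:: h1] isT erefl; rewrite {1}/walk_perm mulg1 => c2.
  apply: connect_trans c2 _; rewrite rot_step.
  have rot1 : rot ^+ i.+1 != 1.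
    by rewrite -order_dvdn gtnNdvd.
  have mid : w * rot ^+ i.+1 \notin S.
    apply: notin; first exact: rot_fix.
    rewrite (_ : _ k != k) ?orbT //.
    by apply: contraNneq rot1 => /(rotation_pow_fix uHs ks) /eqP.
  have S1 := notin_tperm i.+1 h1 (mem_head _ _).
  have S2 : w * (rot ^+ i.+1 * tperm H h2) \notin S.
    by apply: notin_tperm; rewrite !inE eqxx orbT.
  apply: (@connect_trans _ _ (w * rot ^+ i.+1)); apply: connect1.
    rewrite avoiding_sym; last exact: slide_sym.
    by apply: step => //; rewrite permM rotH tpermL.
  by apply: step => //; rewrite permM rotH tpermL.
have N0 := order_gt0 rot; have N1 : #[rot].-1 < #[rot] by rewrite prednK.
apply: connect_trans (round _ N1) _.
have := walk #[rot].-1 (k :: s0) [:: h1] isT erefl; rewrite {1}/walk_perm mulg1.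
by rewrite rot_step prednK // expg_order mul1g -vE.
Qed.

(** The states of [S] are deleted one by one, and walks through them are rerouted
    by [slide_detour]. *)
Lemma slide_connect_avoiding S c g1 g2 :
    #|S| < m -> g1 \notin S -> g2 \notin S -> connect (slide r c) g1 g2 ->
  connect (avoiding S (slide r c)) g1 g2.
Proof.
have [n] := ubnP #|S|; elim: n S => // n IH S; rewrite ltnS => Sn Sm g1S g2S c12.
have [w wS|S0] := pickP (mem S); last first.
  apply: connect_mono c12 => a b ab; rewrite /avoiding ab.
  by rewrite [a \in S]S0 [b \in S]S0.
have sub g : g \notin S -> g \notin S :\ w by apply: contra => /setD1P[].
have SE := cardsD1 w S; rewrite (wS : w \in S) in SE.
apply: (connect_bypass (w := w)) => //; first exact: slide_sym.
  by move=> u v uS vS uw wv; apply: (slide_detour Sm wS).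
by apply: IH; rewrite ?sub //; move: Sn Sm; rewrite SE; lia.
Qed.

End StarPuzzle.


(** * Parity of an arrangement *)

Section Parity.
Variables (T : finType) (A B : {set T}).
Implicit Types (g : {perm T}) (a b : T).

(** A swap along an edge of both graphs changes both terms. *)
Definition parity g := odd_perm g (+) odd #|[set a in A | g a \in B]|.

Lemma parity_same_side g a b :
  a != b -> (a \in A) = (b \in A) -> parity (tperm a b * g) = ~~ parity g.
Proof.
move=> nab AB; rewrite /parity odd_mul_tperm nab /=.
rewrite (_ : [set x in A | _] = tperm a b @: [set x in A | g x \in B]).
  by rewrite (card_imset _ (@perm_inj _ _)); case: (odd_perm g); case: (odd _).
have At x : (tperm a b x \in A) = (x \in A) by case: tpermP => // ->.
apply/setP=> x; rewrite !inE permM; apply/idP/imsetP => [xD|[y + ->]].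
  by exists (tperm a b x); rewrite ?tpermK // !inE At.
by rewrite !inE At tpermK.
Qed.

Lemma parity_crossing g a b :
    (a \in A) != (b \in A) -> (g a \in B) != (g b \in B) ->
  parity (tperm a b * g) = parity g.
Proof.
wlog aA : a b / a \in A.
  move=> H AB gAB; case aA: (a \in A); first exact: H.
  rewrite tpermC; apply: H; rewrite 1?eq_sym //.
  by move: AB; rewrite aA; case: (b \in A).
rewrite aA => bA gab; have {}bA : b \in A = false by move: bA; case: (b \in A).
have nab : a != b by apply: contraTneq aA => ->; rewrite bA.
pose F (h : {perm T}) := [set x in A | h x \in B].
have DE : F (tperm a b * g) :\ a = F g :\ a.
  apply/setP=> x; rewrite !inE; have [//|xa] := eqVneq x a.
  have [->|xb] := eqVneq x b; first by rewrite bA.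
  by rewrite permM tpermD // eq_sym.
have FE : odd #|F (tperm a b * g)| = ~~ odd #|F g|.
  rewrite (cardsD1 a) (cardsD1 a (F g)) DE !inE aA permM tpermL /= !oddD !oddb.
  by move: gab; case: (g a \in B); case: (g b \in B); case: (odd #|_|).
rewrite /parity odd_mul_tperm nab /= -/(F _) -/(F _) FE.
by case: (odd_perm g); case: (odd _).
Qed.

End Parity.

(** * Swapping along two graphs on the same vertex set *)

Section Swapping.
Variables (T : finType) (eX eY : rel T) (A B : {set T}) (c : T) (k m : nat).
Hypothesis eX_sym : symmetric eX.
Hypothesis eY_sym : symmetric eY.
Hypothesis eX_A : forall x y, eX x y -> (x \in A) != (y \in A).
Hypothesis eY_B : forall x y, eY x y -> (x \in B) != (y \in B).
Hypothesis cA : c \in A.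
Hypothesis eX_connected : forall x y, connect eX x y.
Hypothesis eY_connected : k_connected eY k.
Hypothesis k_lt : k < #|T|.
Hypothesis m_ge2 : 1 < m.

Let N := [set a | eX c a].
Hypothesis degree_bound : #|T| + m <= (#|N| + k).+1.
Hypothesis branching : exists v, 2 < #|[set y | eY v y]|.

Implicit Types (g f : {perm T}) (S : {set {perm T}}) (M Z : {set T}).

Local Notation par := (parity A B).

Definition swap : rel {perm T} := fun g g' =>
  [exists a, exists b, [&& eX a b, eY (g a) (g b) & g' == tperm a b * g]].

Lemma swapP g g' :
  reflect (exists a b, [/\ eX a b, eY (g a) (g b) & g' = tperm a b * g]) (swap g g').
Proof.
apply: (iffP existsP) => [[a /existsP[b /and3P[ab gab /eqP ->]]]|[a [b [ab gab ->]]]].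
  by exists a, b.
by exists a; apply/existsP; exists b; rewrite ab gab eqxx.
Qed.

Lemma eX_irr : irreflexive eX. Proof. by move=> x; apply/negP => /eX_A; rewrite eqxx. Qed.
Lemma eY_irr : irreflexive eY. Proof. by move=> x; apply/negP => /eY_B; rewrite eqxx. Qed.

Lemma swap_parity g g' : swap g g' -> par g' = par g.
Proof.
by case/swapP=> a [b [ab gab ->]]; apply: parity_crossing; [apply: eX_A|apply: eY_B].
Qed.

Lemma tperm_mulC g a b : tperm a b * g = g * tperm (g a) (g b).
Proof. by rewrite -tpermJ -conjgC. Qed.

Let A0 := c |: N.

Lemma center_out : c \notin N. Proof. by rewrite inE eX_irr. Qed.

Lemma star_card : #|A0| = #|N|.+1. Proof. by rewrite cardsU1 center_out. Qed.

(** If two adjacent vertices kept at most two neighbours each, then every deleted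
    vertex would be adjacent to both, and there would be a triangle. *)
Lemma branching_avoiding Z : #|Z| + m <= k ->
  exists v h1 h2 h3, [/\ avoiding Z eY v h1, avoiding Z eY v h2, avoiding Z eY v h3
    & uniq [:: h1; h2; h3]].
Proof.
move=> Zk.
suff [v] : exists v, 2 < #|[set y | avoiding Z eY v y]|.
  case/card_gt2P=> h1 [h2 [h3 [[]]]]; rewrite !inE => v1 v2 v3 [n12 n23 n31].
  by exists v, h1, h2, h3; split; rewrite //= !inE negb_or n12 n23 eq_sym n31.
have [Z0|[z zZ]] := set_0Vmem Z.
  have [v v3] := branching; exists v; apply: leq_trans v3 _; apply: subset_leq_card.
  by apply/subsetP=> y; rewrite !inE /avoiding Z0 !inE.
have [v vZ] : exists v, v \notin Z.
  have: 0 < #|~: Z| by have := cardsC Z; lia.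
  by case/card_gt0P=> v; rewrite inE; exists v.
have split_deg u : u \notin Z ->
    #|[set y | eY u y]| = #|[set y in Z | eY u y]| + #|[set y | avoiding Z eY u y]|.
  move=> uZ; rewrite -(cardsID Z); congr (_ + _); apply: eq_card => y.
    by rewrite !inE andbC.
  by rewrite !inE /avoiding uZ andbC.
have deg u := k_connected_degree u eY_irr eY_connected k_lt.
case: (leqP #|[set y | avoiding Z eY v y]| 2) => [v2|]; last by exists v.
have [w vw] : exists w, avoiding Z eY v w.
  have : 0 < #|[set y | avoiding Z eY v y]|.
    have := deg v; rewrite split_deg //.
    have : #|[set y in Z | eY v y]| <= #|Z| by apply/subset_leq_card/subsetP=> y; rewrite inE => /andP[].
    by lia.
  by case/card_gt0P=> w; rewrite inE; exists w.
have wZ : w \notin Z by case/and3P: vw.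
case: (leqP #|[set y | avoiding Z eY w y]| 2) => [w2|]; last by exists w.
have adjacent u : u \notin Z -> #|[set y | avoiding Z eY u y]| <= 2 -> eY u z.
  move=> uZ u2; have sub : [set y in Z | eY u y] \subset Z.
    by apply/subsetP=> y; rewrite inE => /andP[].
  have /eqP ZE : [set y in Z | eY u y] == Z.
    by rewrite eqEcard sub; have := deg u; rewrite split_deg //; lia.
  by move: zZ; rewrite -{1}ZE inE => /andP[].
have := eY_B (adjacent v vZ v2); have := eY_B (adjacent w wZ w2).
case/and3P: vw => _ _ /eY_B.
by case: (v \in B); case: (w \in B); case: (z \in B).
Qed.

(** The claim of the induction, in which [M] grows from the closed star at [c] to
    the whole vertex set. *)
Definition joined M := forall S g1 g2,
  #|S| < m -> g1 \notin S -> g2 \notin S -> {in ~: M, g1 =1 g2} -> par g1 = par g2 ->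
  connect (avoiding S swap) g1 g2.

(** On the star at [c] the swaps are the slides of the hole [c]. *)
Lemma joined_star : joined A0.
Proof.
move=> S g1 g2 Sm g1S g2S g12 par12.
pose Z := g1 @: (~: A0); pose r := avoiding Z eY; pose V := ~: Z.
have inZ x : (g1 x \in Z) = (x \notin A0).
  by rewrite /Z mem_imset ?inE //; apply: perm_inj.
have cardZ : #|Z| + #|N|.+1 = #|T|.
  by rewrite /Z (card_imset _ (@perm_inj _ _)) -star_card addnC cardsC.
have Zk : #|Z| + m <= k by move: degree_bound cardZ; lia.
have r_sym : symmetric r by apply: avoiding_sym.
have r_V x y : r x y -> x \in V by rewrite inE => /and3P[].
have r_B x y : r x y -> (x \in B) != (y \in B) by case/and3P=> _ _ /eY_B.
have r_m (S' : {set T}) u v : #|S'| < m -> u \in V :\: S' -> v \in V :\: S' ->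
    connect (avoiding S' r) u v.
  move=> S'm; rewrite !inE => /andP[uS' uZ] /andP[vS' vZ].
  have card' : #|Z :|: S'| < k by have [+ _] := leq_card_setU Z S'; lia.
  apply: connect_mono (eY_connected card' _ _); rewrite ?inE ?negb_or ?uZ ?vZ //.
  move=> a b; rewrite /r /avoiding !inE !negb_or.
  by case/and3P=> /andP[-> ->] /andP[-> ->] ->.
have two x u v : u \in V :\ x -> v \in V :\ x -> connect (avoiding [set x] r) u v.
  by apply: r_m; rewrite cards1.
have [v [h1 [h2 [h3 [v1 v2 v3 u3]]]]] := branching_avoiding Zk.
have cV : g1 c \in V by rewrite inE inZ negbK !inE eqxx.
pose g := g1^-1 * g2.
have gV : perm_on V g.
  apply/subsetP=> t; rewrite !inE; apply: contra => /imsetP[x xA ->].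
  by rewrite permM permK g12.
have gE : g1 * g = g2 by rewrite mulKVg.
have odd_g : odd_perm g = (g1 c \in B) (+) (g (g1 c) \in B).
  have -> : g (g1 c) = g2 c by rewrite -gE permM.
  have Dc (f : {perm T}) : odd #|[set a in A | f a \in B]| =
      (f c \in B) (+) odd #|[set a in A | f a \in B] :\ c|.
    by rewrite (cardsD1 c) !inE cA /= oddD oddb.
  have DE : [set a in A | g1 a \in B] :\ c = [set a in A | g2 a \in B] :\ c.
    apply/setP=> a; rewrite !inE; have [//|ac] := eqVneq a c.
    have [aA|//] := boolP (a \in A); rewrite g12 // !inE (negPf ac) /=.
    by apply/negP => /eX_A; rewrite cA aA.
  move: par12; rewrite /parity !Dc DE odd_permM odd_permV.
  by case: (odd_perm g1); case: (odd_perm g2); case: (g1 c \in B); case: (g2 c \in B);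
     case: (odd #|_|).
have c12 : connect (slide r c) g1 g2.
  rewrite -[g1]mulg1 -gE slide_connect_mul.
  exact: (wilson r_sym r_V r_B two v1 v2 v3 u3 cV gV odd_g).
have {}c12 := slide_connect_avoiding r_sym r_V r_B r_m Sm g1S g2S c12.
pose P (h : {perm T}) := {in ~: A0, h =1 g1} /\ connect (avoiding S swap) g1 h.
suff [] : P g2 by [].
apply: (connect_invariant P _ _ c12); first by split; rewrite ?connect0.
move=> h h' [hg ch] /and3P[hS h'S /andP[rhh /eqP h'E]].
pose a := h^-1 (h' c).
have ha : h a = h' c by rewrite permKV.
have aA0 : a \in A0.
  apply: contraT => aA0; case/and3P: rhh => _ /negP[].
  by rewrite -ha hg ?in_setC // inZ.
have aN : a \in N.
  move: aA0; rewrite in_setU1 => /predU1P[ac|//].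
  by move: (bip_irr r_B (h c)); rewrite -{2}ac ha rhh.
have h'E' : h' = tperm c a * h by rewrite tperm_mulC ha -h'E.
split.
  move=> x xA; rewrite h'E' permM tpermD ?hg //.
    by move: xA; rewrite !inE negb_or eq_sym => /andP[].
  by apply: contraTneq xA => <-; rewrite inE aA0.
apply: (connect_trans1 ch); rewrite /avoiding hS h'S /=.
apply/swapP; exists c, a; split=> //; first by rewrite inE in aN.
by rewrite ha; case/and3P: rhh.
Qed.

(** The neighbours of [c] can be permuted in more than [#|S|] ways of the right
    parity, and each way spoiled by a deletion accounts for a deleted arrangement
    of its own. *)
Lemma exists_bridge M S g x x' y p :
    #|S| < m -> A0 \subset M -> x \notin M -> x' \in M ->
    g^-1 y \in x |: M -> y != g x ->
  exists f, [/\ f x = y, f x' = g x, {in ~: (x |: M), f =1 g}, par f = p &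
                f \notin S /\ tperm x x' * f \notin S].
Proof.
move=> Sm AM xM x'M yM nyx; set b := g^-1 y in yM.
have gb : g b = y by rewrite permKV.
have bx : b != x by apply: contraNneq nyx => <-; rewrite gb.
have xx' : x != x' by apply: contraNneq xM => ->.
pose N' := N :\ x'.
have NM t : t \in N -> t \in M by move=> tN; apply: (subsetP AM); rewrite inE tN orbT.
have cardN : m.*2 <= #|N|.
  have cX : #|N|.+2 <= #|T|.
    have : #|x |: A0| <= #|T| by apply: max_card.
    by rewrite cardsU1 star_card (contra (subsetP AM x)).
  have := k_connected_bipartite_card c eY_irr eY_sym eY_B eY_connected.
  rewrite k_lt andbT; move: degree_bound m_ge2 cX k_lt; clear; case: (k) => [|k'] /=; lia.
have cardN' : m.*2 <= #|N'|.+1.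
  by apply: leq_trans cardN _; rewrite (cardsD1 x' N); case: (x' \in N).
have /card_gt0P[a aN] : 0 < #|N'| by move: cardN' m_ge2; clear; lia.
have cardNa := cardsD1 a N'; rewrite aN in cardNa.
have /card_gt0P[a0 a0N] : 0 < #|N' :\ a| by move: cardNa cardN' m_ge2; clear; lia.
have inN' t : t \in N' -> [/\ t != x, t != x', t \in M & t \notin A].
  case/setD1P=> tx' tN; split=> //; last 1 first.
  - by move: tN; rewrite inE => /eX_A; rewrite cA; case: (t \in A).
  - by apply: contraNneq xM => <-; apply: NM.
  - exact: NM.
(* the neighbours of [c] lie on one side, so exchanging two of them only changes the parity *)
have flip t u (f : {perm T}) : t \in N' -> u \in N' -> t != u ->
    [/\ (tperm t u * f) x = f x, (tperm t u * f) x' = f x',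
        {in ~: (x |: M), tperm t u * f =1 f} & par (tperm t u * f) = ~~ par f].
  move=> tN uN tu; have [tx tx' tM tA] := inN' t tN; have [ux ux' uM uA] := inN' u uN.
  split; rewrite ?permM ?tpermD //.
    move=> z; rewrite !inE negb_or => /andP[zx zM].
    by rewrite permM tpermD //; apply: contraNneq zM => <-.
  by apply: parity_same_side; rewrite // (negPf tA) (negPf uA).
pose f0 := tperm b x' * (tperm x b * g).
have f0x : f0 x = y by rewrite 2!permM (tpermD bx) 1?eq_sym // tpermL gb.
have f0x' : f0 x' = g x by rewrite 2!permM tpermR tpermR.
have f0M : {in ~: (x |: M), f0 =1 g}.
  move=> z; rewrite !inE negb_or => /andP[zx zM].
  have zb : b != z by apply: contraTneq yM => ->; rewrite !inE negb_or zx zM.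
  have zx' : x' != z by apply: contraNneq zM => <-.
  by rewrite 2!permM !tpermD // eq_sym.
have [f1 [f1x f1x' f1M f1p]] : exists f1 : {perm T}, [/\ f1 x = y, f1 x' = g x,
    {in ~: (x |: M), f1 =1 g} & par f1 = ~~ p].
  have [<-|np] := eqVneq (par f0) (~~ p); first by exists f0.
  have [na aN'] := setD1P a0N.
  rewrite eq_sym in na; have [h1 h2 h3 h4] := flip a a0 f0 aN aN' na.
  exists (tperm a a0 * f0); rewrite h1 // h2 // f0x f0x' h4 //; split=> //.
    by move=> z zM; rewrite h3 // f0M.
  by move: np; case: (par f0); case: (p).
pose F t := tperm a t * f1.
have FE t : t \in N' :\ a -> [/\ F t x = y, F t x' = g x, {in ~: (x |: M), F t =1 g} & par (F t) = p].
  case/setD1P=> ta tN; rewrite eq_sym in ta.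
  have [h1 h2 h3 h4] := flip a t f1 aN tN ta; rewrite /F h1 // h2 // h4 // f1p negbK f1x f1x'; split=> // z zM.
  by rewrite h3 // f1M.
have [[t [tN tS t'S]]|none] : (exists t, [/\ t \in N' :\ a, F t \notin S & tperm x x' * F t \notin S]) \/
    {in N' :\ a, forall t, (F t \in S) || (tperm x x' * F t \in S)}.
  have [/existsP[t /and3P[tN tS t'S]]|none] :=
    boolP [exists t, [&& t \in N' :\ a, F t \notin S & tperm x x' * F t \notin S]].
    by left; exists t.
  right=> t tN; apply: contraR none; rewrite negb_or => /andP[tS t'S].
  by apply/existsP; exists t; rewrite tN tS.
  by have [h1 h2 h3 h4] := FE t tN; exists (F t).
(* otherwise each variant would account for a different deleted arrangement *)
pose phi t := if F t \in S then F t else tperm x x' * F t.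
have phi_inj : {in N' :\ a &, injective phi}.
  have F_inj t u : F t = F u -> t = u.
    by move/permP/(_ a); rewrite !permM !tpermL => /perm_inj.
  move=> t u tN uN; have [tx tx' _ _] := FE t tN; have [ux ux' _ _] := FE u uN.
  rewrite /phi; case: ifP => _; case: ifP => _.
  - exact: F_inj.
  - by move/permP/(_ x)/eqP; rewrite permM tpermL ux' tx (negPf nyx).
  - by move/permP/(_ x)/eqP; rewrite permM tpermL tx' ux eq_sym (negPf nyx).
  - by move/mulgI/F_inj.
have : #|phi @: (N' :\ a)| <= #|S|.
  apply/subset_leq_card/subsetP=> _ /imsetP[t tN ->]; rewrite /phi.
  by case: ifP (none t tN) => //= ->.
rewrite card_in_imset //; move: Sm cardNa cardN' m_ge2; clear; lia.
Qed.

(** The occupant of the new position [x] is changed along a path of the vertices of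
    [Y] that are available for it, each step being one swap with the position [x']. *)
Lemma joined_extend M x x' :
    A0 \subset M -> joined M -> x \notin M -> x' \in M -> eX x x' -> joined (x |: M).
Proof.
move=> AM jM xM x'M xx' S g1 g2 Sm g1S g2S g12 par12.
pose Z := g1 @: ~: (x |: M).
have inZ t : (g1 t \in Z) = (t \notin x |: M).
  by rewrite /Z mem_imset ?inE //; apply: perm_inj.
have AxM : A0 \proper x |: M.
  apply/properP; split; first by apply: subset_trans AM (subsetUr _ _).
  by exists x; rewrite ?setU11 //; apply: contra xM; apply: (subsetP AM).
have cardZ : #|Z| < k.
  have := cardsC (x |: M); rewrite -/(#|Z|) => cM.
  have : #|Z| = #|~: (x |: M)| by rewrite /Z (card_imset _ (@perm_inj _ _)).
  have := proper_card AxM; rewrite star_card.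
  by move: degree_bound m_ge2 cM; clear; lia.
have xxM := setU11 x M.
have c12 : connect (avoiding Z eY) (g1 x) (g2 x).
  apply: eY_connected => //; first by rewrite inZ xxM.
  apply/imsetP=> -[t tM]; rewrite (g12 t tM) => /perm_inj E.
  by move: tM; rewrite -E inE xxM.
pose P y := y \notin Z /\ forall g, g \notin S -> {in ~: (x |: M), g1 =1 g} ->
  par g1 = par g -> g x = y -> connect (avoiding S swap) g1 g.
suff [_] : P (g2 x) by apply.
apply: (connect_invariant P _ _ c12).
  split; first by rewrite inZ xxM.
  move=> g gS gM pg gx; apply: jM => // t; rewrite inE => tM.
  have [->//|tx] := eqVneq t x.
  by apply: gM; rewrite !inE negb_or tx.
move=> y y' [yZ Py] /and3P[_ y'Z yy']; split=> // g gS gM pg gx.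
have nyx : y != g x by rewrite gx; apply: contraTneq yy' => ->; rewrite eY_irr.
have yM : g^-1 y \in x |: M.
  apply: contraR yZ => yM; rewrite -[y](permKV g) -gM ?inZ // inE.
  by [].
have [f [fx fx' fM fp [fS f'S]]] := exists_bridge (par g1) Sm AM xM x'M yM nyx.
have cf : connect (avoiding S swap) g1 f.
  by apply: Py => // t tM; rewrite gM // fM.
have f_swap : swap f (tperm x x' * f).
  by apply/swapP; exists x, x'; split=> //; rewrite fx fx' gx.
have cf' : connect (avoiding S swap) g1 (tperm x x' * f).
  by apply: (connect_trans1 cf); rewrite /avoiding fS f'S f_swap.
apply: connect_trans cf' _.
apply: jM => //; last by rewrite (swap_parity f_swap) fp.
move=> t; rewrite inE => tM; have [->|tx] := eqVneq t x; first by rewrite permM tpermL.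
rewrite permM tpermD //; last by apply: contraNneq tM => <-.
  by rewrite fM // !inE negb_or tx.
by rewrite eq_sym.
Qed.

Theorem swap_connect_avoiding S g1 g2 :
    #|S| < m -> g1 \notin S -> g2 \notin S -> par g1 = par g2 ->
  connect (avoiding S swap) g1 g2.
Proof.
suff jT : joined setT by move=> Sm g1S g2S; apply: jT => // t; rewrite !inE.
have grow M : A0 \subset M -> joined M -> joined setT.
  have [n] := ubnP #|~: M|; elim: n M => // n IH M; rewrite ltnS => Mn AM jM.
  have [/eqP <- //|MT] := boolP (M == setT).
  have [z zM] : exists z, z \notin M.
    by apply/existsP; rewrite -negb_forall; apply: contra MT => /forallP MT; apply/eqP/setP=> z; rewrite MT inE.
  have [/existsP[x' /existsP[x /and3P[x'M xM xx']]]|closed] :=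
    boolP [exists x', exists x, [&& x' \in M, x \notin M & eX x' x]].
    apply: (IH (x |: M)).
    - apply: leq_trans Mn; apply: proper_card; rewrite properC; apply/properP.
      by split; [apply: subsetUr|exists x; rewrite ?setU11].
    - exact: subset_trans AM (subsetUr _ _).
    - by apply: (joined_extend AM jM xM x'M); rewrite eX_sym.
  have cM : c \in M by apply: (subsetP AM); rewrite setU11.
  case/negP: zM; apply: (connect_invariant (fun t => t \in M : Prop) _ _ (eX_connected c z)) => //.
  move=> a b aM ab; apply: contraR closed => bM.
  by apply/existsP; exists a; apply/existsP; exists b; rewrite aM bM.
exact: grow joined_star.
Qed.

(** Transpositions of [c]'s neighbours already give enough arrangements. *)
Lemma card_parity_class p : m <= #|[set g | par g == p]|.
Proof.
have mN : m < #|N|.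
  have cX : #|N| < #|T| by rewrite -star_card max_card.
  have := k_connected_bipartite_card c eY_irr eY_sym eY_B eY_connected.
  rewrite k_lt andbT; move: degree_bound m_ge2 cX k_lt; clear; case: (k) => [|k'] /=; lia.
have /card_gt0P[a aN] : 0 < #|N| by move: mN; clear; case: #|_|.
have cardNa := cardsD1 a N; rewrite aN in cardNa.
have /card_gt0P[a0 /setD1P[a0a a0N]] : 0 < #|N :\ a|.
  by move: cardNa mN m_ge2; clear; lia.
have NA t : t \in N -> t \in A = false.
  by rewrite inE => /eX_A; rewrite cA; case: (t \in A).
have flip f t u : t \in N -> u \in N -> t != u -> par (tperm t u * f) = ~~ par f.
  by move=> tN uN tu; apply: parity_same_side; rewrite // !NA.
have [f fp] : exists f, par f = ~~ p.
  have [E|nE] := eqVneq (par 1) (~~ p); first by exists 1.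
  exists (tperm a a0 * 1); rewrite flip // 1?eq_sym //.
  by move: nE; case: (par 1); case: (p).
have inj t u : tperm a t * f = tperm a u * f -> t = u.
  by move/permP/(_ a); rewrite !permM !tpermL => /perm_inj.
apply: leq_trans (_ : #|N :\ a| <= _); first by move: cardNa mN; clear; lia.
rewrite -(card_imset _ inj); apply/subset_leq_card/subsetP=> _ /imsetP[t /setD1P[ta tN] ->].
by rewrite inE flip // 1?eq_sym // fp negbK.
Qed.

End Swapping.


(** * Two-connected graphs of maximum degree two are cycles *)

Lemma index_next (T : eqType) (p : seq T) x :
  uniq p -> x \in p -> index (next p x) p = (index x p).+1 %% size p.
Proof.
case: p => // y p up xp; rewrite next_nth xp.
have : index x (y :: p) < size (y :: p) by rewrite index_mem.
set i := index _ _; rewrite [size _]/= ltnS leq_eqVlt => /predU1P[->|ip].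
  by rewrite nth_default // modnn /= eqxx.
by rewrite -[nth y p i]/(nth y (y :: p) i.+1) index_uniq // modn_small.
Qed.

Section CycleGraph.
Variables (G : sgraph).
Hypothesis G2 : k_connected (@adj G) 2.
Hypothesis G3 : 2 < #|G|.
Hypothesis deg2 : forall x : G, #|[set y | adj x y]| <= 2.

(** A cycle uses up the degrees of its vertices, so no edge leaves it. *)
Lemma two_regular_cycle : isomorphic G (cycle_graph #|G|).
Proof.
have deg x : #|[set y | @adj G x y]| = 2.
  by apply/eqP; rewrite eqn_leq deg2 (k_connected_degree _ (@adj_irrefl G) G2).
have /card_gt0P[v _] : 0 < #|G| by apply: leq_trans G3.
have /cards2P[h1 [h2 [h12 vE]]] : #|[set y | @adj G v y]| == 2 by rewrite deg.
have [v1 v2] : adj v h1 /\ adj v h2.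
  by move/setP: vE => vE; have := vE h1; have := vE h2; rewrite !inE !eqxx orbT.
have nv h : adj v h -> h \notin [set v].
  by move=> vh; rewrite inE; apply: contraTneq vh => ->; rewrite adj_irrefl.
have c12 : connect (avoiding [set v] (@adj G)) h1 h2 by apply: G2; rewrite ?cards1 ?nv.
have [s [ps ls us sv]] := connect_avoiding_path c12 (nv _ v1).
pose p := v :: h1 :: s.
have up : uniq p.
  by rewrite cons_uniq us andbT; apply/negP => /sv; rewrite inE eqxx.
have cp : path.cycle (@adj G) p by rewrite /= v1 rcons_path ps ls adj_sym.
have sz : 2 < size p.
  by move: ls h12; rewrite /p; case: (s) => //= ->; rewrite eqxx.
have next_prev_neq x : x \in p -> next p x != prev p x.
  move=> xp; apply/eqP => E; have := index_next up xp.
  have nx : next p x \in p by rewrite mem_next.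
  have := index_next up nx; rewrite {1}E next_prev //.
  have := xp; rewrite -index_mem => + e1 e2.
  rewrite e2 in e1; move: e1 sz; move: (index x p) (size p) => i n; clear.
  move=> e1 n2 i_n; have [i1|i1] := leqP n i.+1.
    have iE : i.+1 = n by lia.
    by move: e1; rewrite iE modnn modn_small ?(ltnW n2) //; lia.
  move: e1; rewrite (modn_small i1); have [i2|i2] := leqP n i.+2.
    have iE : i.+2 = n by lia.
    by rewrite iE modnn; lia.
  by rewrite modn_small //; lia.
have nbr x y : x \in p -> adj x y = (y == next p x) || (x == next p y) && (y \in p).
  move=> xp.
  have NE : [set next p x; prev p x] = [set y | adj x y].
    apply/eqP; rewrite eqEcard deg cards2 next_prev_neq // andbT.
    apply/subsetP=> z; rewrite !inE => /orP[]/eqP->; first exact: next_cycle.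
    by rewrite adj_sym; apply: prev_cycle.
  move/setP/(_ y): NE; rewrite in_set2 in_set => <-; congr orb.
  apply/eqP/andP => [->|[/eqP-> yp]]; last by rewrite prev_next.
  by rewrite next_prev // mem_prev.
have all_p x : x \in p.
  have c : connect (@adj G) v x.
    by apply: connect_mono (G2 (S := set0) _ _ _); rewrite ?cards0 ?inE // => a b /and3P[].
  apply: (connect_invariant (fun t => t \in p : Prop) _ _ c); first exact: mem_head.
  by move=> a b ap; rewrite nbr // => /orP[/eqP->|/andP[]//]; rewrite mem_next.
have sizep : size p = #|G|.
  by rewrite -(card_uniqP up); apply: eq_card => x; rewrite all_p.
have lt_index x : index x p < #|G| by rewrite -sizep index_mem.
exists (fun x => Ordinal (lt_index x) : cycle_graph #|G|).
  apply: inj_card_bij; last by rewrite card_ord.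
  by move=> x y E; apply: (index_inj v (all_p x) (all_p y)); apply: (congr1 (@nat_of_ord _) E).
move=> x y; rewrite nbr // all_p andbT.
have inE' z t : (index z p == index t p) = (z == t).
  by apply/eqP/eqP => [|->//]; apply: (index_inj v (all_p z) (all_p t)).
have step z t : (index t p == (index z p).+1 %% #|G|) = (t == next p z).
  by rewrite -[X in _ %% X]sizep -index_next // inE'.
rewrite -[LHS]/((Ordinal (lt_index x) != Ordinal (lt_index y)) &&
  ((index y p == (index x p).+1 %% #|G|) || (index x p == (index y p).+1 %% #|G|))) !step.
have -> : (Ordinal (lt_index x) == Ordinal (lt_index y)) = (x == y).
  by rewrite -val_eqE; apply: inE'.
have [<-|] := eqVneq x y; last by [].
rewrite orbb; apply/esym/negbTE/eqP => xn.
by have := nbr x x (all_p x); rewrite adj_irrefl -xn eqxx.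
Qed.
End CycleGraph.

Lemma exists_branching (G : sgraph) :
    k_connected (@adj G) 2 -> 2 < #|G| -> ~ isomorphic G (cycle_graph #|G|) ->
  exists v : G, 2 < #|[set y | adj v y]|.
Proof.
move=> G2 G3 notC; apply/existsP; apply: contra_notT notC => small.
apply: two_regular_cycle => // x; rewrite leqNgt; apply: contra small => x2.
by apply/existsP; exists x.
Qed.

(** * Components read off a parity *)

Section TwoComponents.
Variables (G : sgraph) (par : G -> bool) (s : nat).
Hypothesis par_adj : forall x y : G, adj x y -> par x = par y.
Hypothesis par_connect : forall (S : {set G}) x y, #|S| < s ->
  x \notin S -> y \notin S -> par x = par y -> connect (avoiding S (@adj G)) x y.
Hypothesis par_card : forall b, s <= #|[set x | par x == b]|.
Hypothesis s_gt0 : 0 < s.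

Lemma connect_par x y : connect (@adj G) x y = (par x == par y).
Proof.
apply/idP/eqP => [|xy].
  by apply: (connect_invariant (fun t => par x = par t)) => // u v -> /par_adj.
have := @par_connect set0 x y; rewrite cards0 !inE => /(_ s_gt0 isT isT xy).
by apply: connect_mono => a b /and3P[].
Qed.

Lemma par_components : components G = [set [set y | par y == b] | b : bool].
Proof.
rewrite components_def; apply/setP=> C; apply/imsetP/imsetP => -[].
  move=> x _ ->; exists (par x) => //; apply/setP=> y.
  by rewrite !inE connect_par eq_sym.
move=> b _ ->; have /card_gt0P[x] := leq_trans s_gt0 (par_card b).
rewrite inE => /eqP xb; exists x => //; apply/setP=> y.
by rewrite !inE connect_par xb eq_sym.
Qed.

Lemma two_components : #|components G| = 2.
Proof.
rewrite par_components card_imset ?card_bool // => b b' /setP E.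
have /card_gt0P[x] := leq_trans s_gt0 (par_card b).
by rewrite inE => xb; have := E x; rewrite !inE xb -(eqP xb) => /esym/eqP.
Qed.

Lemma component_s_connected (C : {set G}) :
  C \in components G -> s_connected s (induced C).
Proof.
rewrite par_components => /imsetP[b _ CE]; apply/forallP=> S; apply/implyP => /eqP Ss.
pose S' := [set val x | x in S].
have S's : #|S'| < s by rewrite card_imset -?Ss //; apply: val_inj.
have CP t : t \in C -> par t = b by rewrite CE inE => /eqP.
have [x0 x0C] : exists x0, x0 \in C :\: S'.
  apply/set0Pn; rewrite -card_gt0; have := cardsID S' C; have := par_card b; rewrite -CE.
  by have := subset_leq_card (subsetIr C S'); move: S's; clear; lia.
have lift x : x \in C -> x \notin S' -> exists y : induced (~: S), val (val y) = x.
  move=> xC xS; have yS : (Sub x xC : induced C) \in ~: S.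
    by rewrite inE; apply: contra xS => xS; apply/imsetP; exists (Sub x xC).
  by exists (Sub (Sub x xC : induced C) yS).
have /setDP[x0C' x0S] := x0C; have [y0 _] := lift x0 x0C' x0S.
apply: (connect_connected y0) => x y.
have out (z : induced (~: S)) : val (val z) \notin S'.
  by apply/imsetP=> -[t tS /val_inj E]; have := valP z; rewrite E inE tS.
have inC (z : induced (~: S)) : par (val (val z)) = b.
  by apply: CP; apply: valP (val z).
have c := par_connect S's (out x) (out y) (etrans (inC x) (esym (inC y))).
pose P t := exists z : induced (~: S), val (val z) = t /\ connect (@adj (induced (~: S))) x z.
have [z [/val_inj/val_inj <-]] : P (val (val y)); last by [].
apply: (connect_invariant P _ _ c); first by exists x; split; rewrite ?connect0.
move=> u v [z [<- xz]] /and3P[_ vS zv].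
have vC : v \in C by rewrite CE inE -(par_adj zv) inC.
have [w wv] := lift v vC vS; exists w; split=> //.
by apply: (connect_trans1 xz); rewrite -wv in zv.
Qed.

End TwoComponents.


(** * Friends-and-strangers graphs as graphs of permutations *)

Section Transport.
Variables (X Y : sgraph) (i0 : X -> Y) (j0 : Y -> X).
Hypotheses (ij : cancel i0 j0) (ji : cancel j0 i0).
Implicit Types (g : {perm Y}) (u v : FS X Y).

(** The graph [X] on the vertices of [Y], so that arrangements become permutations. *)
Definition transported : rel Y := fun a b => adj (j0 a) (j0 b).

Lemma arrangement_subproof g : bijectiveb [ffun x => g (i0 x)].
Proof.
apply/bijectivebP; exists (fun y => j0 (g^-1 y)) => x; first by rewrite ffunE permK ij.
by rewrite ffunE ji permKV.
Qed.

Definition arrangement g : FS X Y := exist (fun f : {ffun X -> Y} => bijectiveb f) _ (arrangement_subproof g).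

Lemma arrangementE g x : val (arrangement g) x = g (i0 x).
Proof. by rewrite ffunE. Qed.

Lemma arrangement_perm_inj u : injective (fun y => val u (j0 y)).
Proof.
move=> a b; have /bijectivebP/bij_inj u_inj := valP u.
by move/u_inj/(can_inj ji).
Qed.

Definition arrangement_perm u : {perm Y} := perm (@arrangement_perm_inj u).

Lemma arrangementK : cancel arrangement arrangement_perm.
Proof. by move=> g; apply/permP=> y; rewrite permE arrangementE ji. Qed.

Lemma arrangement_permK : cancel arrangement_perm arrangement.
Proof.
by move=> u; apply/val_inj/ffunP=> x; rewrite arrangementE permE ij.
Qed.

Lemma adj_arrangement g g' :
  adj (arrangement g) (arrangement g') = swap transported (@adj Y) g g'.
Proof.
apply/existsP/swapP => [[a /existsP[b]]|[a [b [ab gab ->]]]].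
  case/and5P=> nab ab gab /eqP ga /andP[/eqP gb /forallP gc].
  exists (i0 a), (i0 b); rewrite /transported !ij; rewrite !arrangementE in ga gb gab.
  split=> //; apply/permP=> y; rewrite permM.
  have [->|ya] := eqVneq y (i0 a); first by rewrite tpermL gb.
  have [->|yb] := eqVneq y (i0 b); first by rewrite tpermR ga.
  rewrite tpermD 1?eq_sym //; have := gc (j0 y).
  rewrite !inE negb_or -!(inj_eq (can_inj ij)) !ji ya yb /= => /eqP.
  by rewrite !arrangementE ji.
exists (j0 a); apply/existsP; exists (j0 b).
rewrite !arrangementE !ji !permM tpermL tpermR !eqxx gab /=.
have nab : a != b by apply: contraTneq gab => ->; rewrite adj_irrefl.
rewrite (inj_eq (can_inj ji)) nab [adj _ _]ab /=; apply/forallP=> c; apply/implyP.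
rewrite !inE negb_or !arrangementE permM => /andP[ca cb]; rewrite tpermD //.
  by apply: contraNneq ca => ->; rewrite ij.
by apply: contraNneq cb => ->; rewrite ij.
Qed.

Lemma transported_sym : symmetric transported.
Proof. by move=> a b; apply: adj_sym. Qed.

Lemma transported_connect : connected X -> forall a b, connect transported a b.
Proof.
move=> cX a b; have c := connected_connect (j0 a) (j0 b) cX.
suff: connect transported a (i0 (j0 b)) by rewrite ji.
apply: (connect_invariant (fun x => connect transported a (i0 x) : Prop) _ _ c).
  by rewrite ji connect0.
by move=> u v Pu uv; apply: (connect_trans1 Pu); rewrite /transported !ij.
Qed.

End Transport.

Lemma bijection_of_card (X Y : finType) : #|X| = #|Y| ->
  exists (i0 : X -> Y) (j0 : Y -> X), cancel i0 j0 /\ cancel j0 i0.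
Proof.
move=> XY; exists (fun x => enum_val (cast_ord XY (enum_rank x))).
exists (fun y => enum_val (cast_ord (esym XY) (enum_rank y))).
by split=> x; rewrite enum_valK ?cast_ordK ?cast_ordKV enum_rankK.
Qed.

(** The function [par] is [parity] read on arrangements; the second property shows
    that both values occur, even with prescribed people at some places. *)
Lemma fs_parity (X Y : sgraph) (A : {set X}) (B : {set Y}) :
    #|X| = #|Y| ->
    (forall a b : X, adj a b -> (a \in A) != (b \in A)) ->
    (forall a b : Y, adj a b -> (a \in B) != (b \in B)) ->
  exists par : FS X Y -> bool,
    (forall u v : FS X Y, adj u v -> par u = par v) /\
    (forall (u : FS X Y) (a b : X), a != b -> (a \in A) = (b \in A) ->
       exists2 v : FS X Y, forall x, val v x = val u (tperm a b x) & par v = ~~ par u).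
Proof.
move=> XY XA YB; have [i0 [j0 [ij ji]]] := bijection_of_card XY.
pose A' := [set y | j0 y \in A].
exists (fun u => parity A' B (arrangement_perm ji u)); split=> [u v|u a b nab ab].
  rewrite -{1}[u](arrangement_permK ij ji) -{1}[v](arrangement_permK ij ji) adj_arrangement.
  have eX_A x y : transported j0 x y -> (x \in A') != (y \in A') by rewrite !inE => /XA.
  by move/(swap_parity eX_A YB) => ->.
pose g := tperm (i0 a) (i0 b) * arrangement_perm ji u.
exists (arrangement ij ji g).
  move=> x; rewrite arrangementE permM permE; congr (val u _).
  case: tpermP => [/(can_inj ij)->|/(can_inj ij)->|xa xb]; rewrite ij ?tpermL ?tpermR //.
  by rewrite tpermD //; apply/eqP => E; [apply: xa|apply: xb]; rewrite E.
rewrite arrangementK parity_same_side //; first by rewrite (inj_eq (can_inj ij)).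
by rewrite !inE !ij.
Qed.

Lemma max_degree_center (G : sgraph) : 0 < #|G| ->
  exists c : G, #|[set y | adj c y]| = max_degree G.
Proof.
by case/card_gt0P=> x0 _; exists [arg max_(x > x0) #|[set y | adj x y]|]; rewrite /max_degree (bigmax_eq_arg x0).
Qed.

Theorem fs_two_s_connected (s : nat) (X Y : sgraph) :
    1 < s -> #|X| = #|Y| -> connected X -> connected Y -> bipartite X -> bipartite Y ->
    #|Y| + s <= (max_degree X + connectivity Y).+1 ->
    ~ isomorphic Y (cycle_graph #|Y|) ->
  #|components (FS X Y)| = 2 /\
  (forall C : {set FS X Y}, C \in components (FS X Y) -> s_connected s (induced C)).
Proof.
move=> s2 XY cX cY [A0 XA0] [B YB] deg notC.
have Y0 : 0 < #|Y|.
  by rewrite lt0n; apply/negP => /eqP Y0; move: cY; rewrite /connected components_def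
     (_ : [set: Y] = set0) ?imset0 ?cards0 //; apply/eqP; rewrite -cards_eq0 cardsT Y0.
have [c cE] : exists c : X, #|[set y | adj c y]| = max_degree X.
  by apply: max_degree_center; rewrite XY.
have [i0 [j0 [ij ji]]] := bijection_of_card XY.
have [A cA XA] : exists2 A : {set X}, c \in A & forall a b : X, adj a b -> (a \in A) != (b \in A).
  have [cA|cA] := boolP (c \in A0); first by exists A0.
  exists (~: A0); rewrite ?inE // => a b /XA0; rewrite !inE.
  by case: (a \in A0); case: (b \in A0).
pose eX := transported j0; pose A' := [set y | j0 y \in A].
have eX_sym : symmetric eX by apply: transported_sym.
have eX_A (x y : Y) : eX x y -> (x \in A') != (y \in A') by rewrite !inE => /XA.
have cA' : i0 c \in A' by rewrite inE ij.
have eX_c := transported_connect ij ji cX.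
have kY := @k_connected_connectivity Y.
have kle := connectivity_bound Y.
have k_lt : connectivity Y < #|Y| by rewrite -ltnS prednK // in kle.
have NE : #|[set a | eX (i0 c) a]| = max_degree X.
  rewrite -cE -(card_imset _ (can_inj ij)); apply: eq_card => y; rewrite inE /eX /transported ij.
  apply/idP/imsetP => [cy|[x + ->]]; last by rewrite inE ij.
  by exists (j0 y); rewrite ?inE ?ji.
have degN : #|Y| + s <= (#|[set a | eX (i0 c) a]| + connectivity Y).+1 by rewrite NE.
have Dlt : max_degree X < #|Y|.
  rewrite -cE -XY; apply: leq_trans (max_card (mem (c |: [set y | adj c y]))).
  by rewrite cardsU1 inE adj_irrefl.
have k2 : 1 < connectivity Y by move: deg s2 Dlt; clear; lia.
have kY2 : k_connected (@adj Y) 2.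
  by move=> S u v S2; apply: kY; apply: leq_trans S2 k2.
have br : exists v : Y, 2 < #|[set y | adj v y]|.
  by apply: exists_branching => //; apply: leq_trans k_lt.
pose par (u : FS X Y) := parity A' B (arrangement_perm ji u).
have par_adj (u v : FS X Y) : adj u v -> par u = par v.
  rewrite -{1}[u](arrangement_permK ij ji) -{1}[v](arrangement_permK ij ji) adj_arrangement.
  by move/(swap_parity eX_A YB) => E; rewrite /par E.
have par_connect (S : {set FS X Y}) u v : #|S| < s -> u \notin S -> v \notin S ->
    par u = par v -> connect (avoiding S (@adj (FS X Y))) u v.
  move=> Ss uS vS uv; pose S' := [set g | arrangement ij ji g \in S].
  have SE u' : (arrangement_perm ji u' \in S') = (u' \in S).
    by rewrite inE arrangement_permK.
  have S's : #|S'| < s.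
    apply: leq_ltn_trans Ss; rewrite -(card_imset _ (can_inj (arrangementK ij ji))).
    by apply/subset_leq_card/subsetP=> _ /imsetP[g + ->]; rewrite inE.
  have cS : connect (avoiding S' (swap eX (@adj Y))) (arrangement_perm ji u) (arrangement_perm ji v).
    by apply: (swap_connect_avoiding eX_sym (@adj_sym Y) eX_A YB cA' eX_c kY k_lt s2 degN br);
      rewrite ?SE.
  rewrite -[v](arrangement_permK ij ji).
  apply: (connect_invariant (fun g => connect (avoiding S (@adj (FS X Y))) u (arrangement ij ji g) : Prop) _ _ cS).
    by rewrite arrangement_permK connect0.
  move=> g g' Pg /and3P[gS g'S gg']; apply: (connect_trans1 Pg).
  by rewrite /avoiding adj_arrangement gg'; rewrite !inE in gS g'S; rewrite gS g'S.
have par_card b : s <= #|[set u | par u == b]|.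
  apply: leq_trans (card_parity_class (@adj_sym Y) eX_A YB cA' kY k_lt s2 degN b) _.
  rewrite -(card_imset _ (can_inj (arrangementK ij ji))).
  apply/subset_leq_card/subsetP=> _ /imsetP[g + ->].
  by rewrite !inE /par arrangementK.
have s0 : 0 < s by apply: ltnW.
split; first exact: (two_components par_adj par_connect par_card s0).
by move=> C; apply: (component_s_connected par_adj par_connect par_card s0).
Qed.


(** * Brooms *)

Lemma card_ord_lt n k : k <= n -> #|[set i : 'I_n | i < k]| = k.
Proof.
move=> kn; rewrite -[RHS]card_ord.
have inj : injective (widen_ord kn) by move=> i j /(congr1 val) /= E; apply: val_inj.
rewrite -(card_imset _ inj).
apply: eq_card => i; rewrite inE; apply/idP/imsetP => [ik|[j _ ->]]; last exact: (ltn_ord j).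
by exists (Ordinal ik) => //; apply: val_inj.
Qed.

Lemma card_ord_values n (D : {set 'I_n}) (s : seq nat) :
  (forall i, i \in D -> val i \in s) -> #|D| <= size s.
Proof.
move=> Ds; rewrite cardE -(size_map val); apply: uniq_leq_size.
  by rewrite map_inj_uniq ?enum_uniq //; apply: val_inj.
by move=> _ /mapP[i + ->]; rewrite mem_enum; apply: Ds.
Qed.

Section Broom.
Variables (n m : nat).

(** The path [0, 1, ..., m] with all further vertices attached to [m]: it is the
    tree in which the parent of [j > 0] is [minn j.-1 m]. *)
Definition broom_adj : rel 'I_n := fun i j =>
  ((i < j) && (i == minn j.-1 m :> nat)) || ((j < i) && (j == minn i.-1 m :> nat)).

Lemma broom_sym : symmetric broom_adj. Proof. by move=> i j; rewrite /broom_adj orbC. Qed.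
Lemma broom_irr : irreflexive broom_adj. Proof. by move=> i; rewrite /broom_adj ltnn. Qed.

Definition broom : sgraph := SGraph broom_sym broom_irr.

Definition broom_side : {set 'I_n} := [set i : 'I_n | odd (minn i m.+1)].

Lemma broom_bipartite (i j : broom) :
  adj i j -> (i \in broom_side) != (j \in broom_side).
Proof.
wlog ij : i j / i < j.
  move=> H ij; have [lt|lt|E] := ltngtP i j; first exact: H.
    by rewrite eq_sym; apply: H => //; rewrite adj_sym.
  by move: ij; rewrite (val_inj E) adj_irrefl.
rewrite /adj /= /broom_adj ij ltnNge (ltnW ij) /= orbF !inE => /eqP iE.
suff : minn j m.+1 = (minn i m.+1).+1 by move=> ->; rewrite /=; case: (odd _).
by move: iE ij; move: (nat_of_ord i) (nat_of_ord j) => a b; clear; lia.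
Qed.

Hypothesis m_gt0 : 0 < m.
Hypothesis m_lt : m.+1 < n.

Lemma broom_connected : connected broom.
Proof.
have n0 : 0 < n by apply: leq_trans m_lt.
pose r : broom := Ordinal n0.
have to_r k (i : broom) : (i : 'I_n) <= k -> connect (@adj broom) i r.
  elim: k i => [|k IH] i ik.
    by rewrite (_ : i = r) ?connect0 //; apply: val_inj; apply/eqP; rewrite /= -leqn0.
  have [i0|i0] := posnP i; first by apply: IH; rewrite i0.
  have pn : minn i.-1 m < n.
    by move: m_lt; clear; lia.
  have pi : minn i.-1 m < i by move: i0; move: (nat_of_ord i) => a; clear; lia.
  apply: (@connect_trans _ _ (Ordinal pn : broom)).
    by apply: connect1; rewrite /adj /= /broom_adj /= pi eqxx orbT.
  by apply: IH; rewrite -ltnS; apply: leq_trans pi ik.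
apply: (connect_connected r) => i j; apply: (connect_trans (to_r _ i (leqnn _))).
by rewrite connect_adj_sym; apply: to_r.
Qed.

Lemma broom_max_degree : 1 < n - m -> max_degree broom = n - m.
Proof.
move=> nm; have mn : m < n by apply: ltnW.
pose c : broom := Ordinal mn.
have degc : #|[set y | @adj broom c y]| = n - m.
  have -> : [set y | @adj broom c y] = ~: (Ordinal mn |: [set i : 'I_n | i < m.-1]).
    apply/setP=> y; rewrite !inE -val_eqE /adj /= /broom_adj /=.
    by move: m_gt0; move: (nat_of_ord y) => b; clear; lia.
  have := cardsC (Ordinal mn |: [set i : 'I_n | i < m.-1]).
  rewrite cardsU1 !inE /= card_ord_lt ?card_ord; last by move: (mn); clear; lia.
  have -> : (m < m.-1) = false by clear; lia.
  by move: #|~: _| => x; move: m_gt0 (mn); clear; lia.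
apply/eqP; rewrite eqn_leq; apply/andP; split; last first.
  by rewrite -degc; apply: (leq_bigmax c).
apply/bigmax_leqP => i _; have [->|ic] := eqVneq i c; first by rewrite degc.
apply: leq_trans nm.
have [im|im] := ltnP (i : 'I_n) m.
  apply: (@card_ord_values _ _ [:: i.+1; i.-1]) => j; rewrite !inE /adj /= /broom_adj.
  by move: im; move: (nat_of_ord i) (nat_of_ord j) => a b; clear; lia.
apply: (@card_ord_values _ _ [:: m; m]) => j; rewrite !inE /adj /= /broom_adj.
have {}im : m < i by rewrite ltn_neqAle im eq_sym -val_eqE in ic *; rewrite ic.
by move: im; move: (nat_of_ord i) (nat_of_ord j) => a b; clear; lia.
Qed.

End Broom.

(** * Two obstructions for brooms *)

Lemma leq_invariant_components (G : sgraph) (I : finType) (inv : G -> I) :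
  (forall x y, adj x y -> inv x = inv y) -> #|[set inv x | x : G]| <= #|components G|.
Proof.
move=> inv_adj; pose f (C : {set G}) := omap inv [pick x in C].
rewrite -(card_imset _ (@Some_inj _)); apply: leq_trans (leq_imset_card f _).
apply/subset_leq_card/subsetP=> _ /imsetP[_ /imsetP[x _ ->] ->].
apply/imsetP; exists [set y | connect (@adj G) x y].
  by rewrite components_def; apply: imset_f.
rewrite /f; case: pickP => [y|/(_ x)]; last by rewrite inE connect0.
rewrite inE => c /=; congr Some.
by apply: (connect_invariant (fun t => inv x = inv t) _ _ c) => // u v -> /inv_adj.
Qed.

Lemma induced_connected (G : sgraph) (S : {set G}) x0 :
    x0 \notin S ->
    (forall x y, x \notin S -> y \notin S -> connect (avoiding S (@adj G)) x y) ->
  connected (induced (~: S)).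
Proof.
rewrite -in_setC => x0S cS; apply: (connect_connected (Sub x0 x0S : induced (~: S))) => x y.
have out (z : induced (~: S)) : val z \notin S by have := valP z; rewrite inE.
pose P t := exists z : induced (~: S), val z = t /\ connect (@adj (induced (~: S))) x z.
have [z [/val_inj <-]] : P (val y); last by [].
apply: (connect_invariant P _ _ (cS _ _ (out x) (out y))); first by exists x.
move=> u v [z [<- xz]] /and3P[_ vS zv]; rewrite -in_setC in vS.
by exists (Sub v vS); split=> //; apply: (connect_trans1 xz).
Qed.

(** By maximality, the test for one more than the connectivity fails on some set. *)
Lemma exists_cutset (G : sgraph) : (connectivity G).+1 < #|G| ->
  exists (Z : {set G}) (u w : G), [/\ #|Z| = connectivity G, u \notin Z, w \notin Z
    & ~~ connect (avoiding Z (@adj G)) u w].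
Proof.
move=> kG; have : ~~ s_connected (connectivity G).+1 G.
  apply/negP => sG; have := @leq_bigmax_cond _ [pred i : 'I_#|G| | s_connected i G] (fun i => i : nat) (Ordinal kG) sG.
  by rewrite -/(connectivity G) /= ltnn.
rewrite negb_forall => /existsP[Z]; rewrite negb_imply eqSS => /andP[/eqP ZE nc].
have /card_gt0P[x0] : 0 < #|~: Z| by have := cardsC Z; rewrite ZE; move: kG; clear; lia.
rewrite inE => x0Z.
have [/existsP[u /existsP[w /and3P[uZ wZ nuw]]]|none] :=
  boolP [exists u, exists w, [&& u \notin Z, w \notin Z & ~~ connect (avoiding Z (@adj G)) u w]].
  by exists Z, u, w.
case/negP: nc; apply: (induced_connected x0Z) => x y xZ yZ.
apply: contraR none => nxy.
by apply/existsP; exists x; apply/existsP; exists y; rewrite xZ yZ.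
Qed.

Section BroomObstruction.
Variables (n m : nat) (Y : sgraph) (Z U : {set Y}).
Hypothesis m_lt : m < n.
Hypothesis Zm : #|Z| <= m.
Hypothesis U_adj : forall x y : Y,
  adj x y -> x \notin Z -> y \notin Z -> x \in U -> y \in U.

Implicit Types (u v : FS (broom n m) Y).

(** The first person outside [Z] is sought in the order [0, 1, ..., m] of the handle;
    these places are too many to be all taken by [Z]. *)
Definition first_in_side u := [exists i : 'I_n,
  [&& val u i \notin Z, val u i \in U & [forall j : 'I_n, (j < i) ==> (val u j \in Z)]]].

Lemma first_in_sideP u : reflect
  (exists i : 'I_n, [/\ val u i \notin Z, val u i \in U & forall j : 'I_n, j < i -> val u j \in Z])
  (first_in_side u).
Proof.
apply: (iffP existsP) => -[i].
  by case/and3P=> iZ iU /forallP jZ; exists i; split=> // j; apply/implyP.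
case=> iZ iU jZ; exists i; rewrite iZ iU; apply/forallP=> j; apply/implyP; exact: jZ.
Qed.

Lemma too_many u (D : {set 'I_n}) : m < #|D| -> ~ {in D, forall j, val u j \in Z}.
Proof.
move=> mD DZ; have /bijectivebP/bij_inj u_inj := valP u.
have : #|[set val u j | j in D]| <= #|Z|.
  by apply/subset_leq_card/subsetP=> _ /imsetP[j jD ->]; apply: DZ.
by rewrite card_imset // => DZ'; have := leq_trans mD (leq_trans DZ' Zm); rewrite ltnn.
Qed.

(** The first person outside [Z] can only change places with members of [Z] or with
    friends from its own side. It cannot leave the handle by changing places with a
    member of [Z] on a leaf, since this leaf and the places [0, ..., m - 1] would
    then all be taken by [Z]. *)
Lemma first_in_side_adj u v : adj u v -> first_in_side u = first_in_side v.
Proof.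
suff H u' v' : adj u' v' -> first_in_side u' -> first_in_side v'.
  by move=> uv; apply/idP/idP; apply: H; rewrite // adj_sym.
case/existsP=> a /existsP[b] {u v}; move: u' v' => u v.
wlog ab : a b / (a : 'I_n) < (b : 'I_n).
  move=> H hyp; have [lt|lt|E] := ltngtP (a : 'I_n) (b : 'I_n); first exact: (H a b).
    apply: (H b a) => //; move: hyp => /and5P[nab Xab Yab /eqP ua /andP[/eqP ub uc]].
    rewrite eq_sym nab adj_sym Xab adj_sym Yab ua ub !eqxx /=.
    by apply: etrans uc; apply: eq_forallb => c; rewrite setUC.
  by case/and5P: hyp; rewrite (val_inj E) eqxx.
case/and5P=> _ Xab Yab /eqP ua /andP[/eqP ub /forallP uc].
have aE : a = minn b.-1 m :> nat.
  by move: Xab; rewrite /adj /= /broom_adj ab [b < a]ltnNge (ltnW ab) orbF => /eqP.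
have uv j : j != a -> j != b -> val v j = val u j.
  by move=> ja jb; have := uc j; rewrite !inE negb_or ja jb => /eqP.
have ne (j k : 'I_n) : (j : nat) != k -> j != k by rewrite -val_eqE.
case/first_in_sideP=> i [iZ iU jZ]; apply/first_in_sideP.
have im : i <= m.
  rewrite leqNgt; apply/negP => mi; apply: (@too_many u [set j : 'I_n | j < m.+1]).
    by rewrite card_ord_lt.
  by move=> j; rewrite inE => jm; apply: jZ; apply: leq_trans jm mi.
have [ia|nia] := eqVneq i a.
  rewrite ia in iZ iU jZ im.
  have before (j : 'I_n) : j < a -> val v j \in Z.
    move=> ja; rewrite uv ?jZ //; apply: ne; rewrite ltn_eqF //.
    exact: ltn_trans ab.
  have [bZ|bZ] := boolP (val u b \in Z); last first.
    by exists a; split=> //; rewrite -ub //; apply: (U_adj Yab).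
  exists b; rewrite -ua; split=> // j jb.
  have [->|ja] := eqVneq j a; first by rewrite -ub.
  have [am|am] := eqVneq (a : nat) m.
    case: (@too_many u (b |: [set j : 'I_n | j < m])).
      rewrite cardsU1 inE card_ord_lt; last exact: ltnW.
      by rewrite -leqNgt -am (ltnW ab).
    by move=> k; rewrite !inE => /predU1P[->//|km]; apply: jZ; rewrite am.
  apply: before; rewrite ltn_neqAle; apply/andP; split; first by rewrite val_eqE.
  by move: aE am jb; move: (nat_of_ord a) (nat_of_ord b) (nat_of_ord j); clear; lia.
have [ib|nib] := eqVneq i b.
  exists a; rewrite -ub -ib; split=> // j ja.
  have jb : j < b by apply: ltn_trans ab.
  by rewrite uv ?jZ ?ib //; apply: ne; rewrite ltn_eqF.
exists i; rewrite uv //; split=> // j ji.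
have [jE|nja] := eqVneq j a.
  rewrite jE -ub; apply: jZ; rewrite ltnNge leq_eqVlt negb_or; apply/andP; split.
    by rewrite val_eqE.
  apply/negP => ib; move: ji; rewrite jE; move: aE ib im.
  by move: (nat_of_ord a) (nat_of_ord b) (nat_of_ord i); clear; lia.
have [jE|njb] := eqVneq j b.
  by rewrite jE -ua; apply: jZ; apply: ltn_trans ab _; rewrite -jE.
by rewrite uv ?jZ.
Qed.

Lemma first_in_side_head u (i : 'I_n) : i = 0 :> nat -> val u i \notin Z ->
  first_in_side u = (val u i \in U).
Proof.
move=> i0 iZ; apply/first_in_sideP/idP => [[j [jZ jU bef]]|iU]; last first.
  by exists i; split=> // j; rewrite i0.
have [ji|ji] := posnP j; first by rewrite (_ : i = j) //; apply: val_inj; rewrite /= i0 ji.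
by move: iZ; rewrite bef // i0.
Qed.

End BroomObstruction.

Theorem broom_many_components n m (Y : sgraph) :
    3 < n -> m.+1 < n -> #|Y| = n -> connectivity Y <= m -> bipartite Y ->
  3 <= #|components (FS (broom n m) Y)|.
Proof.
move=> n4 mn Yn km [B YB].
have kY : (connectivity Y).+1 < #|Y| by rewrite Yn; move: km mn; clear; lia.
have [Z [x1 [x2 [ZE x1Z x2Z nx]]]] := exists_cutset kY.
pose U := [set y | connect (avoiding Z (@adj Y)) x1 y].
have U_adj (x y : Y) : adj x y -> x \notin Z -> y \notin Z -> x \in U -> y \in U.
  rewrite !inE => xy xZ yZ xU; apply: (connect_trans1 xU).
  by rewrite /avoiding xZ yZ.
have XY : #|broom n m| = #|Y| by rewrite Yn card_ord.
have [par [par_adj par_flip]] := fs_parity XY (@broom_bipartite n m) YB.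
have mn' : m < n by apply: ltnW.
have Zm : #|Z| <= m by rewrite ZE.
pose inv (u : FS (broom n m) Y) := (first_in_side Z U u, par u).
have inv_adj (u v : FS (broom n m) Y) : adj u v -> inv u = inv v.
  by move=> uv; rewrite /inv (first_in_side_adj mn' Zm U_adj uv) (par_adj _ _ uv).
apply: leq_trans (leq_invariant_components inv_adj).
suff -> : [set inv u | u : FS (broom n m) Y] = setT by rewrite cardsT card_prod card_bool.
have n0 : 0 < n by apply: leq_trans n4.
pose o : 'I_n := Ordinal n0.
(* two places on the same side, different from the tip of the handle *)
have [a [b [ao bo nab AB]]] : exists a b : 'I_n, [/\ a != o, b != o, a != b
    & (a \in broom_side n m) = (b \in broom_side n m)].
  have [l1 l2 l3] : [/\ 1 < n, 2 < n & 3 < n] by split=> //; move: n4; clear; lia.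
  pose p1 := Ordinal l1; pose p2 := Ordinal l2; pose p3 := Ordinal l3.
  have [E|] := eqVneq (p1 \in broom_side n m) (p2 \in broom_side n m).
    by exists p1, p2.
  have [E _|] := eqVneq (p1 \in broom_side n m) (p3 \in broom_side n m).
    by exists p1, p3.
  move=> n13 n12; exists p2, p3; split=> //; move: n13 n12.
  by case: (p1 \in _); case: (p2 \in _); case: (p3 \in _).
have start (y : Y) : exists u : FS (broom n m) Y, val u o = y.
  have [i0 [j0 [ij ji]]] := bijection_of_card XY.
  exists (arrangement ij ji (tperm (i0 o) y)).
  by rewrite arrangementE tpermL.
apply/setP=> -[side p]; rewrite [RHS]inE; apply/imsetP.
pose y := if side then x1 else x2.
have yZ : y \notin Z by rewrite /y; case: (side).
have yU : (y \in U) = side.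
  by rewrite /y; case: (side); rewrite inE ?connect0 // (negPf nx).
have [u uo] := start y.
have su (v : FS (broom n m) Y) : val v o = y -> first_in_side Z U v = side.
  by move=> vo; rewrite (@first_in_side_head _ _ _ _ _ _ o) ?vo.
have [E|nE] := eqVneq (par u) p; first by exists u; rewrite // /inv su // E.
have [v vE pv] := par_flip u a b nab AB.
exists v => //; rewrite /inv su; last by rewrite vE tpermD.
by rewrite pv; case: (par u) nE; case: (p).
Qed.

(** * Connectedness and its sharpness *)

Theorem theorem1p6 (s n : nat) (hs : 2 <= s) :
  (forall X Y : sgraph,
     #|X| = n -> #|Y| = n ->
     connected X -> connected Y -> bipartite X -> bipartite Y ->
     n + s - 1 <= max_degree X + connectivity Y ->
     ~ isomorphic Y (cycle_graph n) ->
     #|components (FS X Y)| = 2 /\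
     (forall C : {set FS X Y}, C \in components (FS X Y) -> s_connected s (induced C)))
  /\
  (4 <= n ->
   forall Delta kappa : nat,
     Delta + kappa <= n -> 2 <= Delta <= n - 1 -> 1 <= kappa <= n./2 ->
     exists X : sgraph,
       [/\ #|X| = n, connected X, bipartite X, max_degree X = Delta &
         forall Y : sgraph,
           #|Y| = n -> connected Y -> bipartite Y -> connectivity Y = kappa ->
           3 <= #|components (FS X Y)|]).
Proof.
split=> [X Y Xn Yn cX cY bX bY deg notC|n4 Delta kappa Dk /andP[D2 Dn] /andP[k1 _]].
  apply: fs_two_s_connected => //; first by rewrite Xn Yn.
    by rewrite Yn; move: deg; clear; lia.
  by rewrite Yn.
have m_gt0 : 0 < n - Delta by move: Dn n4; clear; lia.
have m_lt : (n - Delta).+1 < n by move: D2 Dn n4; clear; lia.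
exists (broom n (n - Delta)); split.
- by rewrite card_ord.
- exact: broom_connected.
- by exists (broom_side n (n - Delta)); apply: broom_bipartite.
- by rewrite broom_max_degree //; move: D2 Dn n4; clear; lia.
- move=> Y Yn _ bY kY; apply: broom_many_components => //.
  by rewrite kY; move: Dk; clear; lia.
Qed.
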